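(* Let $d\ge4$ and let $f(x)=\frac12 x^TQx+p^Tx+r$ be a quadratic function on $\mathbb{R}^d$ with $Q$ symmetric positive definite with eigenvalues $\mu=\lambda_1\le\lambda_2\le\dots\le\lambda_{d-1}\le\lambda_d=L$, $0<\mu<L$. Let $\alpha>0$, $\beta,\nu\ge0$ be such that $\rho(A_Q)<1$. If $\lambda_2=\mu$ and $\lambda_{d-1}=L$, then $$r_{\mathbb{R}}(A_Q,B,T)=r_{\mathbb{C}}(A_Q,B,T)=(H_\infty^{\mathrm{lb}})^{-1}=H_\infty^{-1}.$$
   Context: Matrices: with $Q=U\Lambda U^T$ an orthogonal eigendecomposition (eigenvalues in increasing order), $$A_Q=\begin{bmatrix}(1+\beta)I_d-\alpha(1+\nu)Q & -\beta I_d+\alpha\nu Q\\ I_d & 0_d\end{bmatrix},\quad B=\begin{bmatrix}-\alpha I_d\\0_d\end{bmatrix},\quad T=\begin{bmatrix}\tfrac{1}{\sqrt2}\Lambda^{1/2}U^T & 0_d\end{bmatrix}.$$ (These are the system matrices of the generalized momentum method $x_{k+1}=x_k-\alpha\nabla f(y_k)+\beta(x_k-x_{k-1})$, $y_k=x_k+\nu(x_k-x_{k-1})$.) $\rho(\cdot)$ is the spectral radius and $\|\cdot\|$ the spectral norm. The $H_\infty$ norm (for $\rho(A_Q)<1$) is $H_\infty:=\max_{z\in\mathbb{C},|z|=1}\|G(z)\|$ with $G(z):=T(zI-A_Q)^{-1}B$. Stability radii: for $\mathbb{F}\in\{\mathbb{R},\mathbb{C}\}$ and $\varepsilon\ge0$,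 $\rho_\varepsilon^{\mathbb{F}}(A_Q,B,T):=\max_{\Delta\in\mathbb{F}^{d\times d},\|\Delta\|\le\varepsilon}\rho(A_Q+B\Delta T)$ and $r_{\mathbb{F}}(A_Q,B,T):=\inf\{\varepsilon>0:\rho_\varepsilon^{\mathbb{F}}(A_Q,B,T)\ge1\}$. For $\lambda>0$: $b_\lambda:=\alpha\lambda(1+\nu)-(1+\beta)$, $c_\lambda:=\beta-\alpha\lambda\nu$, and $$H_\infty^{\mathrm{lb}}:=\frac{\alpha}{\sqrt2}\max_{\omega\in[0,2\pi]}\min\bigg(\max_{\lambda\in\{\lambda_2,L\}}\frac{\sqrt\lambda}{|e^{2i\omega}+b_\lambda e^{i\omega}+c_\lambda|},\ \max_{\lambda\in\{\mu,\lambda_{d-1}\}}\frac{\sqrt\lambda}{|e^{2i\omega}+b_\lambda e^{i\omega}+c_\lambda|}\bigg).$$ *)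

(* Defs.v *)
From HB Require Import structures.
From mathcomp Require Import all_boot all_order all_algebra.
From mathcomp Require Import all_classical all_reals all_analysis.
From mathcomp Require Import complex.

Set Implicit Arguments.
Unset Strict Implicit.
Unset Printing Implicit Defensive.

Import Order.TTheory GRing.Theory Num.Theory.
Import ComplexField.

Local Open Scope classical_set_scope.
Local Open Scope ring_scope.
Local Open Scope complex_scope.

(* Every mathematical "max" over an infinite set is written [sup]: the sets     *)
(* below are nonempty and bounded (for [Hinf] and [Hlb], when rho(A_Q) < 1), so *)
(* [sup] is their maximum whenever it is attained.                              *)

Definition modulus (R : realType) (z : R[i]) : R := Normc.normc z.

Definition cplxmx (R : realType) (m n : nat) (M : 'M[R]_(m, n)) :
    'M[R[i]]_(m, n) :=
  map_mx (real_complex R) M.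

Definition enorm (R : realType) (n : nat) (v : 'cV[R[i]]_n) : R :=
  Num.sqrt (\sum_(i < n) modulus (v i 0) ^+ 2).

(* Operator norm induced by the Euclidean norm (the analysis library's norm on  *)
(* matrices is the entrywise max norm, which is not the one meant here).        *)
Definition spectral_norm (R : realType) (m n : nat) (M : 'M[R[i]]_(m, n)) : R :=
  sup [set enorm (M *m v) | v in [set v : 'cV[R[i]]_n | enorm v <= 1]].

Definition spectral_radius (R : realType) (n : nat) (A : 'M[R[i]]_n) : R :=
  sup [set modulus l | l in [set l : R[i] | eigenvalue A l]].

Section LinearSystem.
Variables (R : realType) (n m q : nat).
Variables (A : 'M[R]_n) (B : 'M[R]_(n, m)) (T : 'M[R]_(q, n)).

Definition transfer (z : R[i]) : 'M[R[i]]_(q, m) :=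
  cplxmx T *m invmx (z%:M - cplxmx A) *m cplxmx B.

Definition Hinf : R :=
  sup [set spectral_norm (transfer z) | z in [set z : R[i] | modulus z = 1]].

(* [F] is the set of allowed entries of the perturbation, as a subset of R[i]:  *)
(* [Num.real] for real perturbations, [predT] for complex ones.                 *)
Definition rho_eps (F : {pred R[i]}) (eps : R) : R :=
  sup [set spectral_radius (cplxmx A + cplxmx B *m Delta *m cplxmx T)
      | Delta in [set Delta : 'M[R[i]]_(m, q) |
                   Delta \is a mxOver F /\ spectral_norm Delta <= eps]].

(* Extended-real valued, since the infimum may be over the empty set.           *)
Definition stab_radius (F : {pred R[i]}) : \bar R :=
  ereal_inf [set eps%:E | eps in [set eps : R | 0 < eps /\ 1 <= rho_eps F eps]].

Definition real_stab_radius : \bar R := stab_radius Num.real.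
Definition complex_stab_radius : \bar R := stab_radius predT.

End LinearSystem.

Section Momentum.
Variables (R : realType) (d : nat) (alpha beta nu : R).

Definition AQ (Q : 'M[R]_d) : 'M[R]_(d + d) :=
  block_mx ((1 + beta)%:M - (alpha * (1 + nu)) *: Q)
           (- beta%:M + (alpha * nu) *: Q)
           1%:M 0.

Definition Bmx : 'M[R]_(d + d, d) := col_mx (- alpha%:M) 0.

Definition Lambda (lam : d.-tuple R) : 'M[R]_d :=
  diag_mx (\row_i tnth lam i).

Definition Lambda_sqrt (lam : d.-tuple R) : 'M[R]_d :=
  diag_mx (\row_i Num.sqrt (tnth lam i)).

Definition Tmx (U : 'M[R]_d) (lam : d.-tuple R) : 'M[R]_(d, d + d) :=
  row_mx ((Num.sqrt 2)^-1 *: (Lambda_sqrt lam *m U^T)) 0.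

Definition b_ (l : R) : R := alpha * l * (1 + nu) - (1 + beta).
Definition c_ (l : R) : R := beta - alpha * l * nu.

Definition expi (w : R) : R[i] := cos w +i* sin w.

Definition gain (w l : R) : R :=
  Num.sqrt l / modulus (expi (2 * w) + (b_ l)%:C * expi w + (c_ l)%:C).

Definition Hlb (mu lam2 lamd1 L : R) : R :=
  alpha / Num.sqrt 2 *
  sup [set Num.min (Num.max (gain w lam2) (gain w L))
                   (Num.max (gain w mu) (gain w lamd1))
      | w in [set w : R | 0 <= w <= 2 * pi]].

End Momentum.

(* Main.v *)
Require Import Defs.
From HB Require Import structures.
From mathcomp Require Import all_boot all_order all_algebra.
From mathcomp Require Import all_classical all_reals all_analysis.
From mathcomp Require Import complex ring lra.

(** In an orthonormal eigenbasis of Q the system splits into the scalar modes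
    p_l(z) = z^2 + b_l z + c_l, one for each eigenvalue l of Q, and the transfer
    matrix is, up to an orthogonal factor and phases, diagonal with entries
    w_l / |p_l(z)| on the unit circle, where w_l = alpha sqrt(l) / sqrt 2
    ([transfer_modal]).  Three facts then identify the quantities with one number H.

    - The extreme eigenvalues dominate.  If w_l <= H |p_l| on the unit circle for
      l = mu and l = L, the same holds for every eigenvalue in between
      ([circle_sqr_between]).  At a fixed frequency this may fail, because
      l |-> |p_l(z)|^2 / l is convex; it is the minimum over the circle of this
      quantity that is quasiconcave in l.  Hence the maximum over all modes is the
      maximum over mu and L only, which is what the frequency-wise minimum in Hlb
      reduces to when mu and L are both repeated eigenvalues.  Stability makes the
      gain continuous, so this maximum H is attained at some z0 ([Hlb_attained]).

    - No perturbation of norm eps < 1/H destabilizes.  A closed-loop eigenvector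
      for z yields u <> 0 with P(z) u = - (alpha z / sqrt 2) U^T Delta S u, where P(z)
      is diagonal with entries p_l(z) and S with entries sqrt(l)
      ([eigenvalue_modalP]); comparing norms forces |Delta| >= kappa as soon as
      |p_l(z)| >= kappa w_l |z| for all l ([modal_gap_le_norm]).  On the circle the
      latter holds with kappa = 1/H.  It extends to |z| >= 1, because z + c/z maps
      circles around 0 onto confocal, nested ellipses ([quadratic_ge_outside]), and
      to a thin annulus inside the circle with kappa slightly smaller
      ([quadratic_ge_inside]).  The annulus keeps all closed-loop spectral radii
      uniformly below 1, hence also their supremum ([rho_eps_lt1]).

    - A real perturbation of norm 1/H does.  The worst mode belongs to a repeated
      eigenvalue, so the complex number by which the feedback must multiply that
      mode, of modulus 1/H, can be realized by a real scaled rotation of a plane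
      of eigenvectors ([destabilizing_real]).  This is where real and complex
      perturbations become equally powerful. *)

Set Implicit Arguments.
Unset Strict Implicit.
Unset Printing Implicit Defensive.

Import Order.TTheory GRing.Theory Num.Theory.
Import numFieldNormedType.Exports.

Local Open Scope classical_set_scope.
Local Open Scope complex_scope.
Local Open Scope ring_scope.

Local Notation Re := (@complex.Re _).
Local Notation Im := (@complex.Im _).

(** * Worst gains on the unit circle as a function of the eigenvalue *)
Section MiddleEigenvalue.
Variable R : rcfType.
Implicit Types (s e t K : R).

Lemma quadratic_ivt (a b c : R) : 0 <= c -> a + b + c <= 0 ->
  exists2 x, 0 <= x <= 1 & a * x ^+ 2 + b * x + c = 0.
Proof.
move=> c0 abc.
pose p : {poly R} := - (a *: 'X^2 + b *: 'X + c%:P).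
have pE x : p.[x] = - (a * x ^+ 2 + b * x + c).
  by rewrite hornerN !hornerD !hornerZ hornerXn hornerX hornerC.
have [|x] := @poly_ivt R p 0 1 ler01.
  by rewrite !pE; apply/andP; split; lra.
move=> x01; rewrite rootE pE => /eqP h.
by exists x => //; lra.
Qed.

(** With s = alpha l and e = 1 - c_l, so that b_l = s - 2 + e, this is |p_l(z)|^2 at the
    point of the unit circle with real part 1 - t, as [quadratic_circle] shows. *)
Definition circle_sqr s e t : R :=
  s ^+ 2 - 2 * t * (2 * s - e * (s + e)) + 4 * (1 - e) * t ^+ 2.

(** As a quadratic in t, [circle_sqr s e t - K * s] has slope -2N at 0 for
    N = 2 s - e (s + e) and leading coefficient 4 (1 - e).  For e < 1 the condition says
    that its discriminant is nonpositive, i.e. that its minimum over all real t is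
    nonnegative. *)
Definition interior_level K s e : Prop :=
  (2 * s - e * (s + e)) ^+ 2 <= 4 * (1 - e) * s * (s - K).

(** In this form the level condition bounds a sum of two convex functions: a
    quadratic over a linear form, and e^-2 - e^-1, which is convex for e <= 1.  This is
    what makes the set of pairs (s, e) satisfying it convex. *)
Lemma interior_levelE K s e : 0 < s -> 0 < e ->
  interior_level K s e <->
  (s + e) ^+ 2 / s + 4 * K * ((1 - e) / e ^+ 2) <= 4.
Proof.
move=> s0 e0; rewrite /interior_level.
have se0 : 0 < s * e ^+ 2 by rewrite mulr_gt0 // exprn_gt0.
rewrite -[X in _ <-> is_true X](ler_pM2r se0).
have -> : ((s + e) ^+ 2 / s + 4 * K * ((1 - e) / e ^+ 2)) * (s * e ^+ 2) =
   e ^+ 2 * (s + e) ^+ 2 + 4 * K * (1 - e) * s.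
  by field; rewrite !gt_eqF.
by split=> h; nra.
Qed.

Lemma sqr_over_linear_tangent (u v w : R) : 0 < v ->
  2 * w * u - w ^+ 2 * v <= u ^+ 2 / v.
Proof.
move=> v0; rewrite ler_pdivlMr //.
have := sqr_ge0 (u - w * v); nra.
Qed.

Lemma inv_sqr_sub_inv_tangent e x : 0 < e -> 0 < x <= 1 ->
  (1 - e) / e ^+ 2 - (2 - e) / e ^+ 3 * (x - e) <= (1 - x) / x ^+ 2.
Proof.
move=> e0 /andP[x0 x1]; rewrite -subr_ge0.
have -> : (1 - x) / x ^+ 2 - ((1 - e) / e ^+ 2 - (2 - e) / e ^+ 3 * (x - e)) =
   (x - e) ^+ 2 * (2 * x + e * (1 - x)) / (x ^+ 2 * e ^+ 3).
  by field; rewrite !gt_eqF.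
have h : 0 <= e * (1 - x) by rewrite mulr_ge0 ?subr_ge0 // ltW.
apply: divr_ge0; last by rewrite mulr_ge0 // exprn_ge0 // ltW.
by rewrite mulr_ge0 ?sqr_ge0 //; lra.
Qed.

Lemma interior_level_convex K (s1 s2 e1 e2 k1 k2 : R) : 0 <= K ->
  0 < s1 -> 0 < s2 -> 0 < e1 <= 1 -> 0 < e2 <= 1 ->
  0 <= k1 -> 0 <= k2 -> k1 + k2 = 1 ->
  interior_level K s1 e1 -> interior_level K s2 e2 ->
  interior_level K (k1 * s1 + k2 * s2) (k1 * e1 + k2 * e2).
Proof.
move=> K0 s10 s20 /[dup] e1b /andP[e10 e11] /[dup] e2b /andP[e20 e21] k10 k20 k12.
have pos (a b : R) : 0 < a -> 0 < b -> 0 < k1 * a + k2 * b.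
  move=> a0 b0; have [k1p|k1n] := ltP 0 k1.
    apply: ltr_pwDl; first exact: mulr_gt0.
    by apply: mulr_ge0 => //; exact: ltW.
  have k1E : k1 = 0 by lra.
  have k2E : k2 = 1 by lra.
  by rewrite k1E k2E mul0r add0r mul1r.
have s0 := pos _ _ s10 s20; have e0 := pos _ _ e10 e20.
set s := k1 * s1 + _ in s0 *; set e := k1 * e1 + _ in e0 *.
move=> /interior_levelE-/(_ s10 e10) h1 /interior_levelE-/(_ s20 e20) h2.
apply/interior_levelE => //.
have t1 := sqr_over_linear_tangent (s1 + e1) ((s + e) / s) s10.
have t2 := sqr_over_linear_tangent (s2 + e2) ((s + e) / s) s20.
have g1 := inv_sqr_sub_inv_tangent e0 e1b.
have g2 := inv_sqr_sub_inv_tangent e0 e2b.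
have -> : (s + e) ^+ 2 / s =
    2 * ((s + e) / s) * (s + e) - ((s + e) / s) ^+ 2 * s.
  by field; rewrite gt_eqF.
set w := (s + e) / s in t1 t2 *; set q := (2 - e) / e ^+ 3 in g1 g2.
set A1 := _ / s1 in t1 h1; set A2 := _ / s2 in t2 h2.
set G := (1 - e) / e ^+ 2 in g1 g2 *.
set G1 := (1 - e1) / _ in g1 h1; set G2 := (1 - e2) / _ in g2 h2.
have hA : 2 * w * (s + e) - w ^+ 2 * s <= k1 * A1 + k2 * A2.
  apply: le_trans (lerD (ler_wpM2l k10 t1) (ler_wpM2l k20 t2)).
  by rewrite le_eqVlt; apply/orP; left; apply/eqP; rewrite /s /e; ring.
have hG : G <= k1 * G1 + k2 * G2.
  apply: le_trans (lerD (ler_wpM2l k10 g1) (ler_wpM2l k20 g2)).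
  rewrite le_eqVlt; apply/orP; left; apply/eqP.
  transitivity ((k1 + k2) * G - q * (e - (k1 + k2) * e)); last by rewrite {1}/e; ring.
  by rewrite k12; ring.
have := ler_wpM2l K0 hG; have := ler_wpM2l k10 h1; have := ler_wpM2l k20 h2.
nra.
Qed.

Lemma circle_sqr2 s e : circle_sqr s e 2 = (4 - 2 * e - s) ^+ 2.
Proof. by rewrite /circle_sqr; ring. Qed.

Lemma circle_sqr_ge_interior K s e t : 0 < s -> e < 1 -> interior_level K s e ->
  K * s <= circle_sqr s e t.
Proof.
rewrite /interior_level /circle_sqr => s0 e1 h.
set N := 2 * s - _ in h *.
have c0 : 0 < 4 * (1 - e) by lra.
rewrite -subr_ge0 -(pmulr_rge0 _ c0).
have := sqr_ge0 (4 * (1 - e) * t - N); nra.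
Qed.

(** On [0, 2] the quadratic in t is concave if e >= 1, and otherwise monotone when its
    vertex N / (4 (1 - e)) lies outside ]0, 2[; its minimum is then at an end point. *)
Lemma circle_sqr_ge_monotone K s e t : 0 <= t <= 2 ->
  [|| 1 <= e, 2 * s - e * (s + e) <= 0 | 8 * (1 - e) <= 2 * s - e * (s + e)] ->
  K * s <= circle_sqr s e 0 -> K * s <= circle_sqr s e 2 ->
  K * s <= circle_sqr s e t.
Proof.
rewrite /circle_sqr; set N := 2 * s - _ => /andP[t0 t2] hN h0 h2.
have [e1|e1] := leP 1 e.
  have : 0 <= (e - 1) * (t * (2 - t)).
    by rewrite !mulr_ge0 ?subr_ge0.
  have : 0 <= t * (s ^+ 2 - 2 * 2 * N + 4 * (1 - e) * 2 ^+ 2 - K * s).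
    by rewrite mulr_ge0 // subr_ge0.
  have : 0 <= (2 - t) * (s ^+ 2 - 2 * 0 * N + 4 * (1 - e) * 0 ^+ 2 - K * s).
    by rewrite mulr_ge0 // subr_ge0.
  nra.
have et : 0 <= (1 - e) * t by rewrite mulr_ge0 // subr_ge0 ltW.
case/or3P: hN => [|hN|hN]; first by rewrite leNgt e1.
  have : 0 <= - N * t by rewrite mulr_ge0 // oppr_ge0.
  have : 0 <= (1 - e) * t * t by rewrite mulr_ge0.
  nra.
have : 0 <= (2 - t) * (N - 8 * (1 - e)) by rewrite mulr_ge0 // subr_ge0.
have : 0 <= (2 - t) * ((1 - e) * (2 - t)) by rewrite !mulr_ge0 // subr_ge0 // ltW.
nra.
Qed.

(** The bound at (s', e') over t in [0, 2] gives the discriminant condition there only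
    if the vertex of the quadratic lies in [0, 2].  Otherwise the vertex, which is in
    [0, 2] at (s, e), crosses 0 or 2 at some point of the segment; at such a point the
    minimum over all t is the value at t = 0 or t = 2, which is controlled. *)
Lemma interior_level_towards K s e s' e' :
  0 < s -> 0 < s' -> e < 1 -> e' <= 1 ->
  0 <= 2 * s - e * (s + e) <= 8 * (1 - e) ->
  (forall k, 0 <= k <= 1 -> let sk := s + k * (s' - s) in
     let ek := e + k * (e' - e) in
     K * sk <= circle_sqr sk ek 0 /\ K * sk <= circle_sqr sk ek 2) ->
  (forall t, 0 <= t <= 2 -> K * s' <= circle_sqr s' e' t) ->
  exists2 k, 0 <= k <= 1 &
     interior_level K (s + k * (s' - s)) (e + k * (e' - e)).
Proof.
move=> s0 s'0 e1 e'1 /andP[N0 N8] hends h'.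
have cvx k (a b : R) : 0 <= k <= 1 -> 0 < a -> 0 < b -> 0 < a + k * (b - a).
  move=> /andP[k0 k1] a0 b0; have [->|kn0] := eqVneq k 0; first by rewrite mul0r addr0.
  have kb : 0 < k * b by rewrite mulr_gt0 // lt_def kn0.
  have ka : 0 <= (1 - k) * a by rewrite mulr_ge0 ?subr_ge0 // ltW.
  by nra.
have cvx1 k : 0 <= k <= 1 -> e + k * (e' - e) <= 1.
  move=> /andP[k0 k1]; have : 0 <= k * (1 - e') by rewrite mulr_ge0 // subr_ge0.
  have : 0 <= (1 - k) * (1 - e) by rewrite mulr_ge0 // subr_ge0 // ltW.
  by nra.
have lev0 k : 0 <= k <= 1 -> let sk := s + k * (s' - s) in
     let ek := e + k * (e' - e) in 2 * sk - ek * (sk + ek) = 0 ->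
     interior_level K sk ek.
  move=> kb sk ek NE; have [h0 _] := hends _ kb.
  rewrite -/sk -/ek in h0.
  rewrite /interior_level NE expr0n /=.
  have sk0 : 0 < sk by exact: cvx.
  have ek1 : ek <= 1 by exact: cvx1.
  rewrite -mulrA; apply: mulr_ge0; first by lra.
  by move: h0; rewrite /circle_sqr; lra.
(* The coefficients below are those of N as a quadratic in k along the segment. *)
have [N'0|N'0] := ltP (2 * s' - e' * (s' + e')) 0.
  have [||k kb kE] := @quadratic_ivt (- (e' - e) * (s' - s) - (e' - e) ^+ 2)
     (2 * (s' - s) - e * (s' - s) - s * (e' - e) - 2 * e * (e' - e))
     (2 * s - e * (s + e)) => //.
    by lra.
  by exists k => //; apply: lev0 => //=; rewrite -kE; ring.
have [N'8|N'8] := ltP (8 * (1 - e')) (2 * s' - e' * (s' + e')).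
  (* Likewise for 8 * (1 - e) - N, which vanishes when the vertex is at t = 2. *)
  have [||k kb kE] := @quadratic_ivt ((e' - e) * (s' - s) + (e' - e) ^+ 2)
     (- 8 * (e' - e) - (2 * (s' - s) - e * (s' - s) - s * (e' - e) - 2 * e * (e' - e)))
     (8 * (1 - e) - (2 * s - e * (s + e))) => //.
  - by lra.
  - by lra.
  exists k => //.
  have [_] := hends _ kb; have ek1 := cvx1 _ kb.
  set sk := s + _; set ek := e + _ in ek1 *.
  have NE : 2 * sk - ek * (sk + ek) = 8 * (1 - ek).
    by apply/eqP; rewrite -subr_eq0 -oppr_eq0 -kE; apply/eqP; rewrite /sk /ek; ring.
  rewrite /circle_sqr /interior_level NE => h2.
  have : 0 <= (1 - ek) * (sk * (sk - K) - 16 * (1 - ek)).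
    by rewrite mulr_ge0 ?subr_ge0 //; lra.
  nra.
have atone (a b : R) : a + 1 * (b - a) = b by ring.
(* For e' = 1 the two inequalities on N leave only N = 0. *)
have [e'1E|e'n1] := eqVneq e' 1.
  exists 1; rewrite ?ler01 ?lexx //; apply: lev0; rewrite ?ler01 ?lexx //=.
  rewrite !atone; apply/eqP; rewrite eq_le N'0 andbT.
  by move: N'8; rewrite e'1E subrr mulr0.
exists 1; rewrite ?ler01 ?lexx //.
rewrite !atone.
have e'1' : 0 < 1 - e' by rewrite subr_gt0 lt_def eq_sym e'n1.
move: N'0 N'8; set N := 2 * s' - _ => N'0 N'8.
have tb : 0 <= N / (4 * (1 - e')) <= 2.
  by rewrite divr_ge0 //= ?ler_pdivrMr; lra.
have := h' _ tb; rewrite /circle_sqr /interior_level -/N.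
rewrite -(ler_pM2l e'1').
have -> : (1 - e') * (s' ^+ 2 - 2 * (N / (4 * (1 - e'))) * N +
   4 * (1 - e') * (N / (4 * (1 - e'))) ^+ 2) =
   (1 - e') * s' ^+ 2 - N ^+ 2 / 4.
  by field; rewrite gt_eqF //.
nra.
Qed.

(** Quasiconcavity in s of the minimum over the circle of |p_l|^2 / s, along the line
    e = e0 + nu s of the momentum method.  The values at t = 0 and t = 2, which are s and
    (4 - 2 e - s)^2 / s, are monotone in s and hence bounded below by K on the whole
    range.  If the minimum at s is at an interior t, moving from s in both directions
    reaches points satisfying [interior_level], and convexity brings it back to s. *)
Lemma circle_sqr_between K (nu e0 s1 s s2 : R) :
  let e x := e0 + nu * x in
  0 <= K -> 0 <= nu -> 0 < s1 -> s1 <= s <= s2 -> 0 < e s1 ->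
  0 < 4 - 2 * e s2 - s2 ->
  (forall t, 0 <= t <= 2 -> K * s1 <= circle_sqr s1 (e s1) t) ->
  (forall t, 0 <= t <= 2 -> K * s2 <= circle_sqr s2 (e s2) t) ->
  forall t, 0 <= t <= 2 -> K * s <= circle_sqr s (e s) t.
Proof.
move=> e K0 nu0 s10 /andP[s1s ss2] e10 pos2 h1 h2 t tb.
have mono x y : x <= y -> e x <= e y.
  by move=> xy; rewrite lerD2l ler_wpM2l.
have Ks1 : K <= s1.
  have := h1 0; rewrite lexx ler0n => /(_ isT).
  rewrite /circle_sqr mulr0 mul0r subr0 expr0n mulr0 addr0 expr2.
  by rewrite ler_pM2r.
have ends x : s1 <= x <= s2 -> K * x <= circle_sqr x (e x) 0 /\
     K * x <= circle_sqr x (e x) 2.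
  move=> /andP[s1x xs2]; split.
    rewrite /circle_sqr mulr0 mul0r subr0 expr0n mulr0 addr0 expr2.
    by rewrite ler_wpM2r //; lra.
  have := h2 2; rewrite lexx ler0n => /(_ isT); rewrite !circle_sqr2.
  have := mono _ _ xs2 => exs2 h.
  apply: (le_trans (ler_wpM2l K0 xs2)); apply: (le_trans h).
  by rewrite lerXn2r ?nnegrE //; lra.
have h0s x : s1 <= x <= s2 -> 0 < x by move=> /andP[+ _]; exact: lt_le_trans.
have sb : s1 <= s <= s2 by rewrite s1s.
have [hs0 hs2] := ends _ sb.
case: (boolP [|| 1 <= e s, 2 * s - e s * (s + e s) <= 0 |
    8 * (1 - e s) <= 2 * s - e s * (s + e s)]) => [N_out|].
  exact: circle_sqr_ge_monotone.
rewrite !negb_or -!ltNge => /and3P[es1 N0 N8].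
have Nb : 0 <= 2 * s - e s * (s + e s) <= 8 * (1 - e s) by rewrite !ltW.
have s0 := h0s _ sb.
apply: circle_sqr_ge_interior => //.
have toward x : s1 <= x <= s2 -> e x <= 1 ->
   (forall t, 0 <= t <= 2 -> K * x <= circle_sqr x (e x) t) ->
   exists2 k, 0 <= k <= 1 & interior_level K (s + k * (x - s)) (e (s + k * (x - s))).
  move=> xb ex1 hx.
  have [||k kb] := @interior_level_towards K s (e s) x (e x) s0 (h0s _ xb) es1 ex1 Nb.
  - move=> k /andP[k0 k1].
    have -> : e s + k * (e x - e s) = e (s + k * (x - s)) by rewrite /e; ring.
    apply: ends; move: xb sb => /andP[xb1 xb2] /andP[sb1 sb2].
    have : 0 <= k * (x - s1) by rewrite mulr_ge0 ?subr_ge0.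
    have : 0 <= (1 - k) * (s - s1) by rewrite mulr_ge0 ?subr_ge0.
    have : 0 <= k * (s2 - x) by rewrite mulr_ge0 ?subr_ge0.
    have : 0 <= (1 - k) * (s2 - s) by rewrite mulr_ge0 ?subr_ge0.
    by move=> *; apply/andP; split; lra.
  - exact: hx.
  have -> : e s + k * (e x - e s) = e (s + k * (x - s)) by rewrite /e; ring.
  by exists k.
have s1b : s1 <= s1 <= s2 by rewrite lexx (le_trans s1s).
have [k1 k1b lev1] : exists2 k, 0 <= k <= 1 &
    interior_level K (s + k * (s1 - s)) (e (s + k * (s1 - s))).
  by apply: toward => //; apply: le_trans (mono _ _ s1s) _; exact: ltW.
(* Beyond e = 1 the level condition is no longer convex; stop where e reaches 1. *)
have [x2 [sx2 x2s2 ex2 hx2]] : exists x2, [/\ s <= x2, x2 <= s2, e x2 <= 1 &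
    forall t, 0 <= t <= 2 -> K * x2 <= circle_sqr x2 (e x2) t].
  have [es2|es2] := leP (e s2) 1; first by exists s2.
  have nu0' : 0 < nu.
    rewrite lt_def nu0 andbT; apply/eqP => nuE; move: es2 es1.
    by rewrite /e nuE; lra.
  pose x2 := (1 - e0) / nu.
  have ex2 : e x2 = 1 by rewrite /e /x2; field; rewrite gt_eqF.
  have sx2 : s <= x2 by rewrite ler_pdivlMr //; move: es1; rewrite /e; lra.
  have xs2 : x2 <= s2 by rewrite ler_pdivrMr //; move: es2; rewrite /e; lra.
  exists x2; split => //; first by rewrite ex2.
  have [] := ends x2; first by rewrite xs2 (le_trans s1s).
  by move=> hx20 hx22 t' tb'; apply: circle_sqr_ge_monotone => //; rewrite ex2 lexx.
have [k2 k2b lev2] : exists2 k, 0 <= k <= 1 &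
    interior_level K (s + k * (x2 - s)) (e (s + k * (x2 - s))).
  by apply: toward => //; rewrite x2s2 andbT (le_trans s1s).
move: lev1 lev2; set p1 := s + k1 * _; set p2 := s + k2 * _ => lev1 lev2.
have p1b : s1 <= p1 <= s.
  move: k1b => /andP[k10 k11].
  have : 0 <= k1 * (s - s1) by rewrite mulr_ge0 ?subr_ge0.
  have : 0 <= (1 - k1) * (s - s1) by rewrite mulr_ge0 ?subr_ge0.
  by rewrite /p1 => *; apply/andP; split; lra.
have p2b : s <= p2 <= x2.
  move: k2b => /andP[k20 k21].
  have : 0 <= k2 * (x2 - s) by rewrite mulr_ge0 ?subr_ge0.
  have : 0 <= (1 - k2) * (x2 - s) by rewrite mulr_ge0 ?subr_ge0.
  by rewrite /p2 => *; apply/andP; split; lra.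
move: p1b p2b => /andP[p1s1 p1s] /andP[p2s p2x2].
have [p1E|p1n] := eqVneq p1 s; first by rewrite -p1E.
have p12 : 0 < p2 - p1.
  by rewrite subr_gt0 (lt_le_trans _ p2s) // lt_def eq_sym p1n.
have sE : s = (p2 - s) / (p2 - p1) * p1 + (s - p1) / (p2 - p1) * p2.
  by field; rewrite gt_eqF.
have esE : e s = (p2 - s) / (p2 - p1) * e p1 + (s - p1) / (p2 - p1) * e p2.
  by rewrite /e; field; rewrite gt_eqF.
rewrite {1}esE {1}sE; apply: interior_level_convex => //.
- exact: lt_le_trans p1s1.
- exact: lt_le_trans p2s.
- by rewrite (lt_le_trans e10 (mono _ _ p1s1)) /= (le_trans (mono _ _ p1s)) // ltW.
- rewrite (lt_le_trans e10 (mono _ _ _)) /= ?(le_trans (mono _ _ p2x2)) //.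
  by rewrite (le_trans s1s).
- by rewrite divr_ge0 ?subr_ge0 // ltW // -subr_gt0.
- by rewrite divr_ge0 ?subr_ge0 // ltW // -subr_gt0.
by field; rewrite gt_eqF.
Qed.

End MiddleEigenvalue.

(** * Moduli of real quadratics in and around the unit disc *)
Section Modulus.
Variable R : realType.
Implicit Types (z w : R[i]) (x y b c m : R).

Lemma modulus_sqr z : modulus z ^+ 2 = Re z ^+ 2 + Im z ^+ 2.
Proof. by case: z => x y /=; rewrite /modulus /= sqr_sqrtr // addr_ge0 ?sqr_ge0. Qed.

Lemma modulus_ge0 z : 0 <= modulus z.
Proof. by case: z => x y; exact: sqrtr_ge0. Qed.

Lemma modulusM z w : modulus (z * w) = modulus z * modulus w.
Proof. exact: Normc.normcM. Qed.

Lemma modulusD z w : modulus (z + w) <= modulus z + modulus w.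
Proof. exact: le_normcD. Qed.

Lemma modulusN z : modulus (- z) = modulus z.
Proof. exact: normcN. Qed.

Lemma modulusV z : modulus z^-1 = (modulus z)^-1.
Proof. exact: Normc.normcV. Qed.

Lemma modulus0 : modulus (0 : R[i]) = 0.
Proof. exact: Normc.normc0. Qed.

Lemma modulus_eq0 z : (modulus z == 0) = (z == 0).
Proof.
apply/eqP/eqP => [|->]; [exact: Normc.eq0_normc | exact: modulus0].
Qed.

Lemma modulus_real x : modulus x%:C = `|x|.
Proof. by rewrite /modulus /= expr0n addr0 sqrtr_sqr. Qed.

Lemma modulus_eq1 z : modulus z = 1 -> Re z ^+ 2 + Im z ^+ 2 = 1.
Proof. by rewrite -modulus_sqr => ->; rewrite expr1n. Qed.

Definition quadratic b c z : R[i] := z ^+ 2 + b%:C * z + c%:C.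

Lemma quadratic_circle s c z : modulus z = 1 ->
  modulus (quadratic (s - 1 - c) c z) ^+ 2 = circle_sqr s (1 - c) (1 - Re z).
Proof.
move/modulus_eq1; rewrite modulus_sqr /circle_sqr; case: z => x y /= z1.
have yE : y ^+ 2 = 1 - x ^+ 2 by lra.
transitivity (x ^+ 4 + y ^+ 2 * y ^+ 2 + 2 * x ^+ 2 * y ^+ 2
  + (s - 1 - c) ^+ 2 * (x ^+ 2 + y ^+ 2) + c ^+ 2
  + 2 * (s - 1 - c) * x * (x ^+ 2 + y ^+ 2)
  + 2 * c * (x ^+ 2 - y ^+ 2) + 2 * (s - 1 - c) * c * x); first by ring.
by rewrite yE; ring.
Qed.

(** For |z|^2 = rho, this is |z|^2 times the squared modulus of z + c/z + b. *)
Lemma quadratic_sqr b c z : z != 0 ->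
  let rho := modulus z ^+ 2 in
  modulus (quadratic b c z) ^+ 2 =
  rho * ((Re z * (1 + c / rho) + b) ^+ 2 + (Im z * (1 - c / rho)) ^+ 2).
Proof.
move=> z0 rho; have rho0 : rho != 0 by rewrite sqrf_eq0 modulus_eq0.
rewrite modulus_sqr.
have : rho = Re z ^+ 2 + Im z ^+ 2 by rewrite -modulus_sqr.
case: z z0 @rho rho0 => x y z0 rho rho0 /= rhoE.
apply: (mulfI rho0).
transitivity ((x * (rho + c) + b * rho) ^+ 2 + (y * (rho - c)) ^+ 2).
  by rewrite rhoE; ring.
by field.
Qed.

(** Dividing by z, the claim is that z + c/z is at distance at least m from -b.  For
    |z| >= 1 this point lies on or outside the ellipse that z + c/z traces on the unit
    circle, with semi-axes 1 + c and 1 - c, while -b lies inside it.  So the segment from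
    -b to the point crosses that ellipse at a point closer to -b. *)
Lemma quadratic_ge_outside b c m : -1 < c -> c < 1 -> - (1 + c) < b < 1 + c ->
  0 <= m ->
  (forall u, modulus u = 1 -> m <= modulus (quadratic b c u)) ->
  forall z, 1 <= modulus z -> m * modulus z <= modulus (quadratic b c z).
Proof.
move=> cN1 c1 /andP[bN b1] m0 hm z z1.
have z0 : z != 0 by rewrite -modulus_eq0 gt_eqF // (lt_le_trans ltr01).
pose rho := modulus z ^+ 2.
have rho1 : 1 <= rho by rewrite /rho exprn_ege1.
have rho0 : 0 < rho by exact: lt_le_trans rho1.
have rhoE : rho = Re z ^+ 2 + Im z ^+ 2 by rewrite /rho modulus_sqr.
pose X := Re z * (1 + c / rho); pose Y := Im z * (1 - c / rho).
have cp : 0 < 1 + c by lra.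
have cm : 0 < 1 - c by lra.
have outer (g : R) : -1 < g < 1 -> rho^-1 <= ((1 + g / rho) / (1 + g)) ^+ 2.
  move=> /andP[gN g1]; have gp : 0 < 1 + g by lra.
  rewrite -subr_ge0.
  have -> : ((1 + g / rho) / (1 + g)) ^+ 2 - rho^-1 =
     (rho - 1) * (rho - g ^+ 2) / (rho ^+ 2 * (1 + g) ^+ 2).
    by field; rewrite !gt_eqF.
  apply: divr_ge0; last by rewrite mulr_ge0 ?sqr_ge0.
  have g2 : g ^+ 2 <= 1 by nra.
  by rewrite mulr_ge0 // subr_ge0 // (le_trans g2).
(* The crossing of the ellipse is at -b + k (X + b, Y). *)
have [||k kb kE] := @quadratic_ivt R (- (((X + b) / (1 + c)) ^+ 2 + (Y / (1 - c)) ^+ 2))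
    (2 * b * (X + b) / (1 + c) ^+ 2) (1 - (b / (1 + c)) ^+ 2).
- have -> : 1 - (b / (1 + c)) ^+ 2 = (1 + c - b) * (1 + c + b) / (1 + c) ^+ 2.
    by field; rewrite gt_eqF.
  by rewrite divr_ge0 ?sqr_ge0 // mulr_ge0; lra.
- have -> : - (((X + b) / (1 + c)) ^+ 2 + (Y / (1 - c)) ^+ 2) +
      2 * b * (X + b) / (1 + c) ^+ 2 + (1 - (b / (1 + c)) ^+ 2) =
      1 - Re z ^+ 2 * ((1 + c / rho) / (1 + c)) ^+ 2
        - Im z ^+ 2 * ((1 - c / rho) / (1 - c)) ^+ 2.
    by rewrite /X /Y; field; rewrite !gt_eqF.
  have hp : rho^-1 <= ((1 + c / rho) / (1 + c)) ^+ 2 by apply: outer; rewrite cN1.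
  have hq : rho^-1 <= ((1 - c / rho) / (1 - c)) ^+ 2.
    by have := outer (- c); rewrite mulNr; apply; rewrite ltrN2 c1 /= ltrNl cN1.
  have := ler_wpM2l (sqr_ge0 (Re z)) hp; have := ler_wpM2l (sqr_ge0 (Im z)) hq.
  have : Re z ^+ 2 / rho + Im z ^+ 2 / rho = 1.
    by rewrite -mulrDl -rhoE divff // gt_eqF.
  by lra.
have [k0 k1] := andP kb.
pose u0 := (k * (X + b) - b) / (1 + c); pose v0 := k * Y / (1 - c).
have uv : u0 ^+ 2 + v0 ^+ 2 = 1.
  apply/eqP; rewrite -subr_eq0 -oppr_eq0 -kE; apply/eqP.
  by rewrite /u0 /v0; field; rewrite !gt_eqF.
have u1 : modulus (u0 +i* v0) = 1.
  by rewrite /modulus /= uv sqrtr1.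
have hu := hm _ u1.
have unz : u0 +i* v0 != 0 by rewrite -modulus_eq0 u1 oner_eq0.
have : modulus (quadratic b c (u0 +i* v0)) ^+ 2 = k ^+ 2 * ((X + b) ^+ 2 + Y ^+ 2).
  rewrite quadratic_sqr // u1 expr1n !divr1 mul1r /=.
  have -> : u0 * (1 + c) + b = k * (X + b) by rewrite /u0; field; rewrite gt_eqF.
  have -> : v0 * (1 - c) = k * Y by rewrite /v0; field; rewrite gt_eqF.
  by ring.
have zE : modulus (quadratic b c z) ^+ 2 = rho * ((X + b) ^+ 2 + Y ^+ 2).
  by rewrite quadratic_sqr.
move=> uE; rewrite -ler_sqr ?nnegrE ?mulr_ge0 ?modulus_ge0 // zE exprMn mulrC.
rewrite -/rho ler_wpM2l ?(ltW rho0) //.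
have hu2 : m ^+ 2 <= modulus (quadratic b c (u0 +i* v0)) ^+ 2.
  by rewrite ler_sqr ?nnegrE // modulus_ge0.
apply: le_trans hu2 _; rewrite uE -[leRHS]mul1r ler_wpM2r ?addr_ge0 ?sqr_ge0 //.
by rewrite expr_le1.
Qed.

(** With u = z / |z| and r = |z|, the difference between p(z) and r p(u) is
    (1 - r) (c - r u^2), of modulus at most 2 (1 - r). *)
Lemma quadratic_ge_inside b c m : `|c| <= 1 ->
  (forall u, modulus u = 1 -> m <= modulus (quadratic b c u)) ->
  forall z, 0 < modulus z <= 1 ->
  m * modulus z - 2 * (1 - modulus z) <= modulus (quadratic b c z).
Proof.
move=> c1 hm z; set r := modulus z => /andP[r0 r1].
pose u := z / r%:C.
have rC0 : r%:C != 0 by rewrite -modulus_eq0 modulus_real normr_eq0 gt_eqF.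
have u1 : modulus u = 1.
  by rewrite /u modulusM modulusV modulus_real gtr0_norm // divff // gt_eqF.
have zE : z = r%:C * u by rewrite /u mulrC divfK.
clearbody u; have := hm _ u1; set mu := modulus _ => hmu.
have qE : r%:C * quadratic b c u =
    quadratic b c z + (((r * (1 - r))%:C * (u * u)) - (c * (1 - r))%:C).
  by rewrite zE /quadratic !rmorphM !rmorphB /= rmorph1; ring.
have : r * mu <= modulus (quadratic b c z) + (r * (1 - r) + `|c| * (1 - r)).
  have -> : r * mu = modulus (r%:C * quadratic b c u).
    by rewrite modulusM modulus_real gtr0_norm.
  rewrite qE.
  apply: le_trans (modulusD _ _) _; rewrite lerD2l.
  apply: le_trans (modulusD _ _) _; rewrite modulusN !modulusM !modulus_real u1.
  by rewrite !mulr1 !normrM (gtr0_norm r0) ger0_norm // subr_ge0.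
have : 0 <= (1 - `|c|) * (1 - r) by rewrite mulr_ge0 // subr_ge0.
have : 0 <= (1 - r) * (1 - r) by rewrite mulr_ge0 // subr_ge0.
have := ler_wpM2l (ltW r0) hmu.
by lra.
Qed.

Lemma quadratic_large b c z m : `|c| <= modulus z -> m + `|b| + 1 <= modulus z ->
  m * modulus z <= modulus (quadratic b c z).
Proof.
move=> cz bz.
have zE : z ^+ 2 = quadratic b c z + (- (b%:C * z) - c%:C) by rewrite /quadratic; ring.
have : modulus z ^+ 2 <= modulus (quadratic b c z) + (`|b| * modulus z + `|c|).
  rewrite expr2 -modulusM -expr2 zE.
  apply: le_trans (modulusD _ _) _; rewrite lerD2l.
  by apply: le_trans (modulusD _ _) _; rewrite !modulusN modulusM !modulus_real.
have := ler_wpM2r (modulus_ge0 z) bz.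
by lra.
Qed.

(** If 1 - b + c <= 0, the smaller real root is at most -1. *)
Lemma stable_quadratic_lt b c :
  (forall z, quadratic b c z = 0 -> modulus z < 1) -> b < 1 + c.
Proof.
move=> h; rewrite ltNge; apply/negP => hb.
have d0 : 0 <= b ^+ 2 - 4 * c by have := sqr_ge0 (b - 2); nra.
set x := (- b - Num.sqrt (b ^+ 2 - 4 * c)) / 2.
have sE := sqr_sqrtr d0.
have : modulus x%:C < 1.
  apply: h; rewrite /quadratic -rmorphXn -rmorphM -!rmorphD /= -[RHS](rmorph0 (real_complex R)).
  by congr (_%:C); rewrite /x; set q := Num.sqrt _ in sE *; nra.
rewrite modulus_real ltNge => /negP; apply.
have : `|b - 2| <= Num.sqrt (b ^+ 2 - 4 * c).
  by rewrite -sqrtr_sqr ler_wsqrtr //; nra.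
move=> hs; rewrite ler_normr; apply/orP; right; rewrite /x.
have := ler_norm (- (b - 2)); rewrite normrN; lra.
Qed.

(** The Schur-Cohn (Jury) conditions: c is the product of the two roots, and both
    1 - b + c and 1 + b + c, the values at -1 and 1, have to be positive. *)
Lemma stable_quadratic b c :
  (forall z, quadratic b c z = 0 -> modulus z < 1) ->
  [/\ -1 < c, c < 1 & - (1 + c) < b < 1 + c].
Proof.
move=> h.
have hb := stable_quadratic_lt h.
have hbN : - b < 1 + c.
  apply: stable_quadratic_lt => z; rewrite /quadratic rmorphN => zE.
  by rewrite -modulusN; apply: h; rewrite -zE /quadratic; ring.
suff : `|c| < 1 by rewrite ltr_norml => /andP[? ?]; split => //; rewrite ltrNl hbN.
set q := sqrtc (b%:C ^+ 2 - 4 * c%:C).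
have qE : q ^+ 2 = b%:C ^+ 2 - 4 * c%:C by rewrite sqr_sqrtc.
pose z1 := (- b%:C + q) / 2; pose z2 := (- b%:C - q) / 2.
have two0 : (2 : R[i]) != 0 by rewrite pnatr_eq0.
have zz : z1 * z2 = c%:C.
  have -> : z1 * z2 = (b%:C ^+ 2 - q ^+ 2) / 4 by rewrite /z1 /z2; field.
  by rewrite qE; field.
have h1 : modulus z1 < 1.
  by apply: h; rewrite /quadratic -zz /z1 /z2; field.
have h2 : modulus z2 < 1.
  by apply: h; rewrite /quadratic -zz /z1 /z2; field.
rewrite -modulus_real -zz modulusM.
by have := modulus_ge0 z1; have := modulus_ge0 z2; nra.
Qed.

End Modulus.

(** * Suprema, Euclidean norm and spectral norm *)

(** The nonnegativity of [C] covers the empty set, whose [sup] is 0. *)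
Lemma sup_le_nonneg (R : realType) (S : set R) (C : R) :
  0 <= C -> (forall x, S x -> x <= C) -> sup S <= C.
Proof.
move=> C0 hS; have [->|/set0P S0] := eqVneq S set0; first by rewrite sup0.
by apply: ge_sup => // x; exact: hS.
Qed.

Lemma le_sup_bounded (R : realType) (S : set R) (C x : R) :
  (forall y, S y -> y <= C) -> S x -> x <= sup S.
Proof. by move=> hS Sx; apply: ub_le_sup => //; exists C. Qed.

Section Euclidean.
Variable R : realType.
Implicit Types (n m : nat) (C : R).

Lemma enorm_ge0 n (v : 'cV[R[i]]_n) : 0 <= enorm v.
Proof. exact: sqrtr_ge0. Qed.

Lemma enorm_sqr n (v : 'cV[R[i]]_n) : enorm v ^+ 2 = \sum_i modulus (v i 0) ^+ 2.
Proof. by rewrite sqr_sqrtr // sumr_ge0 // => i _; rewrite sqr_ge0. Qed.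

Lemma enorm0 n : enorm (0 : 'cV[R[i]]_n) = 0.
Proof.
rewrite /enorm big1 ?sqrtr0 // => i _.
by rewrite mxE modulus0 expr0n.
Qed.

Lemma modulus_le_enorm n (v : 'cV[R[i]]_n) i : modulus (v i 0) <= enorm v.
Proof.
rewrite -ler_sqr ?nnegrE ?modulus_ge0 ?enorm_ge0 // enorm_sqr (bigD1 i) //=.
by rewrite lerDl sumr_ge0 // => j _; rewrite sqr_ge0.
Qed.

Lemma enorm_gt0 n (v : 'cV[R[i]]_n) : v != 0 -> 0 < enorm v.
Proof.
move=> v0; rewrite lt_def enorm_ge0 andbT; apply: contra v0 => /eqP vE.
apply/eqP/matrixP => i j; rewrite ord1 mxE; apply/eqP.
by rewrite -modulus_eq0 eq_le modulus_ge0 andbT -vE modulus_le_enorm.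
Qed.

Lemma le_enorm n C (u : 'cV[R[i]]_n) (v : 'cV[R[i]]_n) : 0 <= C ->
  (forall i, modulus (u i 0) <= C * modulus (v i 0)) -> enorm u <= C * enorm v.
Proof.
move=> C0 h; rewrite -ler_sqr ?nnegrE ?mulr_ge0 ?enorm_ge0 //.
rewrite exprMn !enorm_sqr mulr_sumr ler_sum // => i _; rewrite -exprMn.
by rewrite ler_sqr ?nnegrE ?mulr_ge0 ?modulus_ge0.
Qed.

Lemma enormZ n (a : R[i]) (v : 'cV[R[i]]_n) : enorm (a *: v) = modulus a * enorm v.
Proof.
apply/eqP; rewrite -(eqrXn2 (n := 2)) ?mulr_ge0 ?enorm_ge0 ?modulus_ge0 //.
rewrite exprMn !enorm_sqr mulr_sumr; apply/eqP/eq_bigr => i _.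
by rewrite mxE modulusM exprMn.
Qed.

Lemma enorm_sqr_dot n (v : 'cV[R[i]]_n) :
  (enorm v ^+ 2)%:C = ((map_mx conjc v)^T *m v) 0 0.
Proof.
rewrite enorm_sqr rmorph_sum mxE; apply: eq_bigr => i _.
by rewrite !mxE mulrC -sqr_normc rmorphXn.
Qed.

Lemma enorm_orthogonal n (W : 'M[R]_n) (v : 'cV[R[i]]_n) : W^T *m W = 1%:M ->
  enorm (cplxmx W *m v) = enorm v.
Proof.
move=> WW; apply/eqP; rewrite -(eqrXn2 (n := 2)) ?enorm_ge0 //; apply/eqP.
apply: complexI; rewrite !enorm_sqr_dot map_mxM.
have -> : map_mx conjc (cplxmx W) = cplxmx W.
  by apply/matrixP => i j; rewrite !mxE conjc_real.
rewrite trmx_mul !mulmxA -(mulmxA _ (cplxmx W)^T) /cplxmx !matrix.map_trmx -map_mxM.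
by rewrite WW map_mx1 mulmx1.
Qed.

Lemma enorm_mul_bounded n m (M : 'M[R[i]]_(m, n)) :
  exists C, forall v : 'cV_n, enorm v <= 1 -> enorm (M *m v) <= C.
Proof.
exists (Num.sqrt (\sum_i (\sum_j modulus (M i j)) ^+ 2)) => v v1.
rewrite ler_wsqrtr // ler_sum // => i _.
rewrite ler_sqr ?nnegrE ?modulus_ge0 ?sumr_ge0 // => [|j _]; last exact: modulus_ge0.
rewrite mxE; apply: (@le_trans _ _ (\sum_j modulus (M i j * v j 0))).
  elim/big_ind2: _ => //; first by rewrite modulus0.
  by move=> x1 x2 y1 y2 h1 h2; apply: le_trans (modulusD _ _) _; exact: lerD.
apply: ler_sum => j _; rewrite modulusM ler_piMr ?modulus_ge0 //.
exact: le_trans (modulus_le_enorm _ _) v1.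
Qed.

Lemma le_spectral_norm n m (M : 'M[R[i]]_(m, n)) (v : 'cV_n) :
  enorm v <= 1 -> enorm (M *m v) <= spectral_norm M.
Proof.
move=> v1; have [C hC] := enorm_mul_bounded M.
apply: (@le_sup_bounded _ _ C); last by exists v.
by move=> _ [w w1 <-]; exact: hC.
Qed.

Lemma enorm_mul_le n m (M : 'M[R[i]]_(m, n)) (v : 'cV_n) :
  enorm (M *m v) <= spectral_norm M * enorm v.
Proof.
have [->|v0] := eqVneq v 0; first by rewrite mulmx0 !enorm0 mulr0.
have vp := enorm_gt0 v0.
have vC : enorm ((enorm v)^-1%:C *: v) = 1.
  by rewrite enormZ modulus_real ger0_norm ?invr_ge0 ?enorm_ge0 // mulVf // gt_eqF.
have := @le_spectral_norm _ _ M ((enorm v)^-1%:C *: v).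
rewrite vC lexx => /(_ isT); rewrite -scalemxAr enormZ modulus_real.
by rewrite ger0_norm ?invr_ge0 ?enorm_ge0 // mulrC ler_pdivrMr.
Qed.

Lemma spectral_norm_le n m (M : 'M[R[i]]_(m, n)) C : 0 <= C ->
  (forall v : 'cV_n, enorm (M *m v) <= C * enorm v) -> spectral_norm M <= C.
Proof.
move=> C0 h; apply: sup_le_nonneg => // _ [v /= v1 <-].
by apply: le_trans (h v) _; rewrite ler_piMr.
Qed.

Lemma mul_diagE n (d : 'rV[R[i]]_n) (v : 'cV[R[i]]_n) i :
  (diag_mx d *m v) i 0 = d 0 i * v i 0.
Proof. by rewrite mul_diag_mx mxE. Qed.

Lemma mul_delta_mxE n (i j : 'I_n) (v : 'cV[R[i]]_n) k :
  (cplxmx (delta_mx i j) *m v) k 0 = (k == i)%:R * v j 0.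
Proof.
rewrite /cplxmx map_delta_mx mxE (bigD1 j) //= mxE eqxx andbT big1 ?addr0 //.
by move=> l lj; rewrite mxE (negPf lj) andbF mul0r.
Qed.

(** The rotation-dilation by a + ib of the coordinate plane (i, j), zero elsewhere.  As a
    complex matrix it has eigenvector e_i - 'i e_j with eigenvalue a + ib. *)
Definition plane_rotation n (i j : 'I_n) (a b : R) : 'M[R]_n :=
  a *: (delta_mx i i + delta_mx j j) + b *: (delta_mx j i - delta_mx i j).

Lemma plane_rotationE n (i j : 'I_n) a b (v : 'cV[R[i]]_n) k : i != j ->
  (cplxmx (plane_rotation i j a b) *m v) k 0 =
  if k == i then a%:C * v i 0 - b%:C * v j 0
  else if k == j then b%:C * v i 0 + a%:C * v j 0 else 0.
Proof.
move=> ij; rewrite /plane_rotation /cplxmx map_mxD !map_mxZ map_mxD map_mxB.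
rewrite mulmxDl -!scalemxAl mulmxDl mulmxBl.
have addE (x y : 'cV[R[i]]_n) l : (x + y) l 0 = x l 0 + y l 0 by rewrite mxE.
have oppE (x : 'cV[R[i]]_n) l : (- x) l 0 = - x l 0 by rewrite mxE.
have sclE c (x : 'cV[R[i]]_n) l : (c *: x) l 0 = c * x l 0 by rewrite mxE.
rewrite !(addE, oppE, sclE) !mul_delta_mxE.
have [->|ki] := eqVneq k i; first by rewrite (negPf ij) /=; ring.
by case: eqP => _ /=; ring.
Qed.

Lemma plane_rotation_norm n (i j : 'I_n) a b : i != j ->
  spectral_norm (cplxmx (plane_rotation i j a b)) <= modulus (a +i* b).
Proof.
move=> ij; apply: spectral_norm_le => [|v]; first exact: modulus_ge0.
rewrite -ler_sqr ?nnegrE ?mulr_ge0 ?enorm_ge0 ?modulus_ge0 //.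
have ji : j != i by rewrite eq_sym.
rewrite exprMn !enorm_sqr (bigD1 i) //= (bigD1 j) //=.
rewrite big1 ?addr0 => [|k /andP[ki kj]]; last first.
  by rewrite plane_rotationE // (negPf ki) (negPf kj) modulus0 expr0n.
rewrite !plane_rotationE // !eqxx (negPf ji).
rewrite [\sum_k _](bigD1 i) //= (bigD1 j) //=.
set r := \sum_(k | _) _.
have r0 : 0 <= r by apply: sumr_ge0 => k _; rewrite sqr_ge0.
apply: (@le_trans _ _ (modulus (a +i* b) ^+ 2 *
   (modulus (v i 0) ^+ 2 + modulus (v j 0) ^+ 2))); last first.
  by rewrite ler_wpM2l ?sqr_ge0 // addrA lerDl.
rewrite !modulus_sqr; case: (v i 0) => x y; case: (v j 0) => x' y' /=.
by rewrite le_eqVlt; apply/orP; left; apply/eqP; ring.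
Qed.

End Euclidean.

(** * Modal decomposition of the closed loop *)

(** [eigenvalue] refers to row vectors; transposition lets column eigenvectors be used. *)
Lemma eigenvalue_trmx (F : fieldType) n (A : 'M[F]_n) a :
  eigenvalue A^T a = eigenvalue A a.
Proof.
rewrite /eigenvalue /eigenspace !kermx_eq0 !row_free_unit -unitmx_tr.
by rewrite raddfB /= trmxK tr_scalar_mx.
Qed.

Lemma eigenvalue_colP (F : fieldType) n (A : 'M[F]_n) a :
  reflect (exists2 v : 'cV_n, A *m v = a *: v & v != 0) (eigenvalue A a).
Proof.
rewrite -eigenvalue_trmx; apply: (iffP eigenvalueP) => -[v vE v0].
  by exists v^T; rewrite ?trmx_eq0 // -[A]trmxK -trmx_mul vE linearZ.
by exists v^T; rewrite ?trmx_eq0 // -trmx_mul vE linearZ.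
Qed.

Section ClosedLoop.
Variables (R : realType) (d : nat) (alpha beta nu : R).
Variables (Q U : 'M[R]_d) (lam : d.-tuple R).
Hypothesis UU : U *m U^T = 1%:M.
Hypothesis QE : Q = U *m Lambda lam *m U^T.

Local Notation W := (cplxmx U).
Local Notation S := (cplxmx (Lambda_sqrt lam)).
Local Notation A := (AQ alpha beta nu Q).
Local Notation B := (Bmx d alpha).
Local Notation T := (Tmx U lam).

Definition modal_char (i : 'I_d) (z : R[i]) : R[i] :=
  quadratic (b_ alpha beta nu (tnth lam i)) (c_ alpha beta nu (tnth lam i)) z.

Definition modal_mx (z : R[i]) : 'M[R[i]]_d := diag_mx (\row_i modal_char i z).

Definition modal_weight (i : 'I_d) : R := alpha / Num.sqrt 2 * Num.sqrt (tnth lam i).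

Lemma orthogonal_trmx : U^T *m U = 1%:M.
Proof. exact: mulmx1C UU. Qed.

Lemma cplx_orthogonal : W *m W^T = 1%:M.
Proof. by rewrite /cplxmx matrix.map_trmx -map_mxM UU map_mx1. Qed.

Lemma cplx_orthogonal_tr : W^T *m W = 1%:M.
Proof. exact: mulmx1C cplx_orthogonal. Qed.

Lemma cplx_mode m (D : 'M[R]_d) (u : 'M[R[i]]_(d, m)) :
  cplxmx (U *m D *m U^T) *m (W *m u) = W *m (cplxmx D *m u).
Proof.
rewrite /cplxmx !map_mxM /= -matrix.map_trmx -!mulmxA (mulmxA W^T).
by rewrite cplx_orthogonal_tr mul1mx.
Qed.

(** Eliminating one half of the state turns z - A_Q into the quadratic pencil
    z^2 - z K1 - K2, with K1 and K2 the upper blocks of A_Q; the eigenbasis of Q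
    diagonalizes it into the modal characteristic polynomials. *)
Lemma modal_pencil m (z : R[i]) (u : 'M[R[i]]_(d, m)) :
  W *m (modal_mx z *m u) = z ^+ 2 *: (W *m u)
    - z *: (cplxmx ((1 + beta)%:M - (alpha * (1 + nu)) *: Q) *m (W *m u))
    - cplxmx (- beta%:M + (alpha * nu) *: Q) *m (W *m u).
Proof.
have scalE (a : R) : a%:M = U *m a%:M *m U^T.
  by rewrite mul_mx_scalar -scalemxAl UU scalemx1.
have -> : (1 + beta)%:M - (alpha * (1 + nu)) *: Q =
   U *m ((1 + beta)%:M - (alpha * (1 + nu)) *: Lambda lam) *m U^T.
  by rewrite {1}scalE QE mulmxBr mulmxBl -scalemxAr -scalemxAl.
have -> : - beta%:M + (alpha * nu) *: Q =
   U *m (- beta%:M + (alpha * nu) *: Lambda lam) *m U^T.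
  by rewrite {1}scalE QE mulmxDr mulmxDl mulmxN mulNmx -scalemxAr -scalemxAl.
rewrite !cplx_mode ![_ *: (W *m _)]scalemxAr -!mulmxBr; congr (_ *m _).
have diagE (a b : R) : cplxmx (a%:M + b *: Lambda lam) *m u =
    \matrix_(i, j) ((a + b * tnth lam i)%:C * u i j).
  have -> : a%:M + b *: Lambda lam = diag_mx (\row_i (a + b * tnth lam i)).
    by apply/matrixP => i j; rewrite !mxE; case: eqP => _; rewrite /= ?mulr0 ?addr0.
  by rewrite /cplxmx map_diag_mx mul_diag_mx; apply/matrixP => i j; rewrite !mxE.
have NE : - beta%:M = (- beta)%:M :> 'M[R]_d by rewrite raddfN.
rewrite -[- (_ *: Lambda lam)]scaleNr NE !diagE mul_diag_mx.
apply/matrixP => i j; rewrite !mxE /modal_char /quadratic /b_ /c_.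
by rewrite !(rmorphD, rmorphM, rmorphN, rmorphB) /= rmorph1; ring.
Qed.

(** The lower block row of the eigenvector equation forces the shape (l y, y); then
    u = U^T y turns the upper one into the equation below. *)
Lemma eigenvalue_modalP (Delta : 'M[R[i]]_d) (l : R[i]) :
  eigenvalue (cplxmx A + cplxmx B *m Delta *m cplxmx T) l <->
  exists2 u : 'cV_d, u != 0 &
    W *m (modal_mx l *m u) =
      (- (alpha / Num.sqrt 2)%:C * l) *: (Delta *m (S *m u)).
Proof.
pose K1 := cplxmx ((1 + beta)%:M - (alpha * (1 + nu)) *: Q).
pose K2 := cplxmx (- beta%:M + (alpha * nu) *: Q).
pose T1 := cplxmx ((Num.sqrt 2)^-1 *: (Lambda_sqrt lam *m U^T)).
have ME : cplxmx A + cplxmx B *m Delta *m cplxmx T =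
    block_mx (K1 - alpha%:C *: (Delta *m T1)) K2 1%:M 0.
  rewrite /cplxmx map_block_mx map_col_mx map_row_mx !raddf0 map_mx1.
  rewrite map_mxN map_scalar_mx mul_col_mx mul0mx mul_col_row !mul0mx mulmx0.
  by rewrite add_block_mx !addr0 mulNmx mul_scalar_mx mulNmx scalemxAl.
have TE (u : 'cV_d) : T1 *m (W *m u) = (Num.sqrt 2)^-1%:C *: (S *m u).
  rewrite /T1 /cplxmx map_mxZ map_mxM -scalemxAl -mulmxA (mulmxA _ _ u).
  by rewrite -map_mxM orthogonal_trmx map_mx1 mul1mx.
have rhsE (u : 'cV_d) : (- (alpha / Num.sqrt 2)%:C * l) *: (Delta *m (S *m u)) =
    - (alpha%:C * l) *: (Delta *m T1 *m (W *m u)).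
  rewrite -mulmxA TE -scalemxAr scalerA; congr (_ *: _).
  by rewrite rmorphM /=; ring.
rewrite ME; split.
  move=> /eigenvalue_colP[v]; rewrite -[v]vsubmxK.
  set x := usubmx v; set y := dsubmx v.
  rewrite mul_block_col mul1mx mul0mx addr0 scale_col_mx.
  move=> /eq_col_mx[E1 E2] v0.
  have yE : W *m (W^T *m y) = y by rewrite mulmxA cplx_orthogonal mul1mx.
  exists (W^T *m y).
    apply: contra v0 => /eqP u0; rewrite E2.
    have -> : y = 0 by rewrite -yE u0 mulmx0.
    by rewrite scaler0 col_mx0.
  rewrite rhsE modal_pencil yE -/K1 -/K2.
  move: E1; rewrite E2 scalerA -expr2 => <-.
  rewrite mulmxBl -!scalemxAr -!scalemxAl scalerA.
  by rewrite addrAC addrK scaleNr addrAC subrr add0r mulrC.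
move=> [u u0]; rewrite rhsE modal_pencil -/K1 -/K2 => E.
apply/eigenvalue_colP; exists (col_mx (l *: (W *m u)) (W *m u)).
  rewrite mul_block_col mul1mx mul0mx addr0 scale_col_mx; congr col_mx.
  rewrite scalerA -expr2 mulmxBl -!scalemxAr -!scalemxAl scalerA.
  move/eqP: E; rewrite subr_eq subr_eq => /eqP ->.
  by rewrite scaleNr [l * _]mulrC -addrA addrC.
apply: contra u0 => /eqP; rewrite -col_mx0 => /eq_col_mx[_ Wu].
by rewrite -[u]mul1mx -cplx_orthogonal_tr -mulmxA Wu mulmx0.
Qed.

Definition closed_loop (Delta : 'M[R[i]]_d) : 'M[R[i]]_(d + d) :=
  cplxmx A + cplxmx B *m Delta *m cplxmx T.

Lemma closed_loop0 : closed_loop 0 = cplxmx A.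
Proof. by rewrite /closed_loop mulmx0 mul0mx addr0. Qed.

Lemma cplx_sqrtE (u : 'cV[R[i]]_d) i :
  (S *m u) i 0 = (Num.sqrt (tnth lam i))%:C * u i 0.
Proof. by rewrite /cplxmx map_diag_mx mul_diagE !mxE. Qed.

Lemma modal_mxE z (u : 'cV[R[i]]_d) i :
  (modal_mx z *m u) i 0 = modal_char i z * u i 0.
Proof. by rewrite mul_diagE !mxE. Qed.

Section Positive.
Variable mu : R.
Hypothesis mu0 : 0 < mu.
Hypothesis mu_le : forall i, mu <= tnth lam i.
Hypothesis alpha0 : 0 < alpha.

Lemma lam_gt0 i : 0 < tnth lam i.
Proof. exact: lt_le_trans (mu_le i). Qed.

Lemma gain_factor_gt0 : 0 < alpha / Num.sqrt 2.
Proof. by rewrite divr_gt0 // sqrtr_gt0. Qed.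

Lemma modal_weight_gt0 i : 0 < modal_weight i.
Proof. by rewrite mulr_gt0 ?gain_factor_gt0 // sqrtr_gt0 lam_gt0. Qed.

(** Both sides of the modal equation are compared in norm: the left one is at least
    kappa |l| (alpha / sqrt 2) |S u|, the right one at most |Delta| |l| (alpha / sqrt 2) |S u|. *)
Lemma modal_gap_le_norm Delta l kappa : 0 <= kappa -> l != 0 ->
  eigenvalue (closed_loop Delta) l ->
  (forall i, kappa * modal_weight i * modulus l <= modulus (modal_char i l)) ->
  kappa <= spectral_norm Delta.
Proof.
move=> kappa0 l0 /eigenvalue_modalP[u u0 uE] gap.
set g := alpha / Num.sqrt 2 in uE.
have g0 : 0 < g by exact: gain_factor_gt0.
have lp : 0 < modulus l by rewrite lt_def modulus_eq0 l0 modulus_ge0.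
have Su0 : 0 < enorm (S *m u).
  have /cV0Pn[i ui0] := u0.
  apply: lt_le_trans (modulus_le_enorm _ i).
  rewrite lt_def modulus_ge0 andbT modulus_eq0 cplx_sqrtE mulf_neq0 //.
  by rewrite -modulus_eq0 modulus_real normr_eq0 gt_eqF // sqrtr_gt0 lam_gt0.
have e1 : enorm (modal_mx l *m u) = g * modulus l * enorm (Delta *m (S *m u)).
  rewrite -(enorm_orthogonal _ orthogonal_trmx) uE enormZ modulusM modulusN.
  by rewrite modulus_real gtr0_norm.
have e2 : kappa * g * modulus l * enorm (S *m u) <= enorm (modal_mx l *m u).
  have k0 : 0 <= kappa * g * modulus l by rewrite !mulr_ge0 ?modulus_ge0 // ltW.
  have -> : kappa * g * modulus l * enorm (S *m u) =
      enorm ((kappa * g * modulus l)%:C *: (S *m u)).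
    by rewrite enormZ modulus_real ger0_norm.
  rewrite -[leRHS]mul1r; apply: le_enorm => // i.
  rewrite mul1r mxE cplx_sqrtE modal_mxE !modulusM !modulus_real.
  rewrite (ger0_norm k0) (ger0_norm (sqrtr_ge0 _)) mulrA.
  apply: ler_wpM2r; first exact: modulus_ge0.
  by apply: le_trans (gap i); rewrite /modal_weight -/g le_eqVlt; apply/orP; left;
     apply/eqP; ring.
have := enorm_mul_le Delta (S *m u).
rewrite -(ler_pM2l (mulr_gt0 g0 lp)) -e1 => e3.
have gS : 0 < g * modulus l * enorm (S *m u) by rewrite !mulr_gt0.
rewrite -(ler_pM2r gS); have := le_trans e2 e3; lra.
Qed.

(** Uniform boundedness is what makes the suprema defining [spectral_radius] and
    [rho_eps] meaningful; it follows from the quadratic growth of the modes. *)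
Lemma closed_loop_eigenvalue_bounded eps : exists C, forall Delta l,
  spectral_norm Delta <= eps -> eigenvalue (closed_loop Delta) l -> modulus l <= C.
Proof.
pose f i := (`|eps| + 1) * modal_weight i
    + `|b_ alpha beta nu (tnth lam i)| + `|c_ alpha beta nu (tnth lam i)| + 1.
have f0 i : 0 <= (`|eps| + 1) * modal_weight i.
  by rewrite mulr_ge0 ?addr_ge0 // ltW // modal_weight_gt0.
have f1 i : 0 <= f i by rewrite /f !addr_ge0.
exists (1 + \sum_i f i) => Delta l De le; rewrite leNgt; apply/negP => lC.
have s0 : 0 <= \sum_i f i by apply: sumr_ge0.
have fl i : f i <= modulus l.
  apply: le_trans (ltW lC); rewrite (bigD1 i) //= addrCA lerDl addr_ge0 //.
  by apply: sumr_ge0.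
have : `|eps| + 1 <= spectral_norm Delta.
  apply: (modal_gap_le_norm _ _ le); first by rewrite addr_ge0.
    by rewrite -modulus_eq0 gt_eqF //; lra.
  move=> i; apply: quadratic_large.
    apply: le_trans (fl i); have := f0 i.
    by have := normr_ge0 (b_ alpha beta nu (tnth lam i)); rewrite /f; lra.
  apply: le_trans (fl i).
  by have := normr_ge0 (c_ alpha beta nu (tnth lam i)); rewrite /f; lra.
by have := ler_norm eps; lra.
Qed.

Lemma eigenvalue_le_radius Delta l : eigenvalue (closed_loop Delta) l ->
  modulus l <= spectral_radius (closed_loop Delta).
Proof.
move=> le; have [C hC] := closed_loop_eigenvalue_bounded (spectral_norm Delta).
apply: (@le_sup_bounded _ _ C); last by exists l.
by move=> _ [k /= ke <-]; exact: hC ke.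
Qed.

Lemma radius_le_rho_eps (F : {pred R[i]}) Delta eps : Delta \is a mxOver F ->
  spectral_norm Delta <= eps ->
  spectral_radius (closed_loop Delta) <= rho_eps A B T F eps.
Proof.
move=> DF De; have [C hC] := closed_loop_eigenvalue_bounded eps.
apply: (@le_sup_bounded _ _ (Num.max C 0)); last by exists Delta.
move=> _ [D [_ De'] <-]; apply: sup_le_nonneg; first by rewrite le_max lexx orbT.
by move=> _ [k /= ke <-]; rewrite le_max (hC _ _ De' ke).
Qed.

Lemma rho_eps_le (F : {pred R[i]}) eps r : 0 <= r ->
  (forall Delta l, spectral_norm Delta <= eps -> eigenvalue (closed_loop Delta) l ->
     modulus l <= r) -> rho_eps A B T F eps <= r.
Proof.
move=> r0 h; apply: sup_le_nonneg => // _ [D [_ De] <-].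
by apply: sup_le_nonneg => // _ [k /= ke <-]; exact: h ke.
Qed.

Hypothesis stable : spectral_radius (cplxmx A) < 1.

(** A root of a mode is an eigenvalue of the unperturbed matrix: take Delta = 0. *)
Lemma modal_char_stable i z : modal_char i z = 0 -> modulus z < 1.
Proof.
move=> zE; apply: le_lt_trans stable; rewrite -closed_loop0.
apply: eigenvalue_le_radius; apply/eigenvalue_modalP.
exists (delta_mx i 0).
  by apply/cV0Pn; exists i; rewrite mxE !eqxx oner_eq0.
rewrite mul0mx scaler0; have -> : modal_mx z *m delta_mx i 0 = 0 :> 'cV_d.
  apply/matrixP => k j; rewrite ord1 modal_mxE !mxE andbT.
  by case: eqP => [->|_]; rewrite ?zE ?mul0r ?mulr0.
by rewrite mulmx0.
Qed.

Lemma modal_char_neq0 i z : 1 <= modulus z -> modal_char i z != 0.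
Proof. by move=> z1; apply/eqP => /modal_char_stable; rewrite ltNge z1. Qed.

Lemma modal_schur i : let l := tnth lam i in
  [/\ -1 < c_ alpha beta nu l, c_ alpha beta nu l < 1 &
     - (1 + c_ alpha beta nu l) < b_ alpha beta nu l < 1 + c_ alpha beta nu l].
Proof. by apply: stable_quadratic => z; exact: modal_char_stable. Qed.

Definition modal_gain z : 'rV[R[i]]_d :=
  \row_i (- (modal_weight i)%:C * z / modal_char i z).

(** The second block of (z - A_Q)^-1 B is z^-1 times the first, since the lower block
    row of z - A_Q is (-1, z); the first then solves the quadratic pencil. *)
Lemma transfer_modal z : modulus z = 1 ->
  transfer A B T z = diag_mx (modal_gain z) *m W^T.
Proof.
move=> z1; have z0 : z != 0 by rewrite -modulus_eq0 z1 oner_eq0.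
have zA : z%:M - cplxmx A \in unitmx.
  have : ~~ eigenvalue (cplxmx A) z.
    apply/negP; rewrite -closed_loop0 => /eigenvalue_le_radius.
    by rewrite closed_loop0 z1 leNgt stable.
  rewrite /eigenvalue /eigenspace kermx_eq0 row_free_unit negbK.
  by rewrite -opprB -scaleN1r unitmxZ // unitrN1.
pose Y : 'M[R[i]]_d := diag_mx (\row_i (- alpha%:C * z / modal_char i z)) *m W^T.
pose X := W *m Y.
have XE : (z%:M - cplxmx A) *m col_mx X (z^-1 *: X) = cplxmx B.
  rewrite /cplxmx map_block_mx map_col_mx !raddf0 map_mx1 scalar_mx_block.
  rewrite opp_block_mx add_block_mx mul_block_col map_mxN map_scalar_mx.
  congr col_mx; last first.
    rewrite add0r subr0 mulNmx mul1mx mul_scalar_mx scalerA divff // scale1r.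
    by rewrite addNr.
  rewrite add0r mulmxBl mul_scalar_mx mulNmx -scalemxAr.
  apply: (scalerI z0); rewrite scalerBr scalerBr !scalerA divff // scale1r -expr2.
  rewrite -modal_pencil /Y /modal_mx (mulmxA (diag_mx _) (diag_mx _)) mulmx_diag.
  have -> : diag_mx (\row_j ((\row_i modal_char i z) 0 j *
      (\row_i (- alpha%:C * z / modal_char i z)) 0 j)) = (- alpha%:C * z)%:M.
    rewrite -diag_const_mx; congr diag_mx; apply/matrixP => k i; rewrite !mxE.
    by rewrite mulrC divfK // modal_char_neq0 // z1.
  rewrite mul_scalar_mx -scalemxAr cplx_orthogonal scalemx1.
  have NE : - (alpha%:C)%:M = (- alpha%:C)%:M :> 'M[R[i]]_d by rewrite raddfN.
  by rewrite NE scale_scalar_mx mulrC.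
rewrite /transfer -XE -mulmxA mulKmx //.
rewrite /cplxmx map_row_mx mul_row_col raddf0 mul0mx addr0 /X.
rewrite map_mxZ map_mxM -scalemxAl -mulmxA (mulmxA _ _ Y) -map_mxM orthogonal_trmx.
rewrite map_mx1 mul1mx /Y map_diag_mx !mulmxA mulmx_diag scalemxAl; congr (_ *m _).
rewrite -linearZ /=; congr diag_mx; apply/matrixP => k i; rewrite !mxE.
by rewrite /modal_weight !rmorphM /=; ring.
Qed.

Lemma transfer_norm_le H z : modulus z = 1 -> 0 <= H ->
  (forall i, modal_weight i <= H * modulus (modal_char i z)) ->
  spectral_norm (transfer A B T z) <= H.
Proof.
move=> z1 H0 h; rewrite transfer_modal //; apply: spectral_norm_le => // v.
have UUT : (U^T)^T *m U^T = 1%:M by rewrite trmxK.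
rewrite -[enorm v](enorm_orthogonal v UUT) -mulmxA /cplxmx matrix.map_trmx.
apply: le_enorm => // i; rewrite mul_diagE modulusM.
apply: ler_wpM2r; first exact: modulus_ge0.
rewrite mxE !modulusM modulusN modulusV modulus_real z1 mulr1.
rewrite (gtr0_norm (modal_weight_gt0 i)) ler_pdivrMr //.
by rewrite lt_def modulus_ge0 modulus_eq0 modal_char_neq0 // z1.
Qed.

Lemma le_transfer_norm z i : modulus z = 1 ->
  modal_weight i / modulus (modal_char i z) <= spectral_norm (transfer A B T z).
Proof.
move=> z1; rewrite transfer_modal //.
pose e : 'cV[R[i]]_d := delta_mx i 0.
have e1 : enorm e = 1.
  rewrite /enorm (bigD1 i) //= big1 ?addr0 => [|j ji].
    by rewrite mxE !eqxx -[1%R]/(1%:C) modulus_real normr1 expr1n sqrtr1.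
  by rewrite mxE (negPf ji) modulus0 expr0n.
have We : enorm (W *m e) <= 1 by rewrite (enorm_orthogonal _ orthogonal_trmx) e1.
apply: le_trans (le_spectral_norm _ We).
apply: le_trans (modulus_le_enorm _ i).
rewrite -mulmxA (mulmxA W^T) cplx_orthogonal_tr mul1mx mul_diagE !mxE !eqxx mulr1.
rewrite !modulusM modulusN modulusV modulus_real z1 mulr1.
by rewrite (gtr0_norm (modal_weight_gt0 i)).
Qed.

(** * The peak gain as reciprocal of the stability radii

    The number H bounds all modal gains on the circle, and is attained at z0 by a mode
    whose eigenvalue is repeated. *)
Section Peak.
Variable H : R.
Hypothesis H0 : 0 < H.
Hypothesis peak_max : forall i z, modulus z = 1 ->
  modal_weight i <= H * modulus (modal_char i z).
Variables (i0 j0 : 'I_d) (z0 : R[i]).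
Hypothesis ij0 : i0 != j0.
Hypothesis double : tnth lam i0 = tnth lam j0.
Hypothesis z01 : modulus z0 = 1.
Hypothesis peak_attained : modal_weight i0 = H * modulus (modal_char i0 z0).

Lemma Hinf_peak : Hinf A B T = H.
Proof.
have ub z : modulus z = 1 -> spectral_norm (transfer A B T z) <= H.
  by move=> z1; apply: transfer_norm_le => // [|i]; [exact: ltW | exact: peak_max].
apply/eqP; rewrite eq_le; apply/andP; split.
  by apply: sup_le_nonneg => [|_ [z z1 <-]]; [exact: ltW | exact: ub].
apply: le_trans (le_sup_bounded (C := H) _ _); first last.
- by exists z0.
- by move=> _ [z z1 <-]; exact: ub.
apply: le_trans (le_transfer_norm i0 z01).
by rewrite peak_attained mulfK // modulus_eq0 modal_char_neq0 // z01.
Qed.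

Lemma modal_char_peak_outside i z : 1 <= modulus z ->
  H^-1 * modal_weight i * modulus z <= modulus (modal_char i z).
Proof.
move=> z1; have [c1 c2 b12] := modal_schur i.
apply: quadratic_ge_outside => // [|u u1].
  by rewrite mulr_ge0 // ?invr_ge0 ltW // modal_weight_gt0.
by rewrite mulrC ler_pdivrMr // mulrC; exact: peak_max.
Qed.

(** A bound on every closed-loop spectral radius would only give a supremum at most 1.
    Strictness comes from the slack between eps and 1/H: kappa lies halfway, and r < 1
    is chosen so that the gap kappa persists on the annulus r <= |z| <= 1. *)
Lemma rho_eps_lt1 (F : {pred R[i]}) eps : 0 <= eps -> eps < H^-1 ->
  rho_eps A B T F eps < 1.
Proof.
move=> eps0 epsH; pose kappa := (eps + H^-1) / 2.
pose w := alpha / Num.sqrt 2 * Num.sqrt mu.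
have w0 : 0 < w by rewrite mulr_gt0 ?gain_factor_gt0 // sqrtr_gt0.
have w_le i : w <= modal_weight i.
  by rewrite ler_pM2l ?gain_factor_gt0 // ler_wsqrtr // mu_le.
have kH : kappa < H^-1 by rewrite /kappa; lra.
have ek : eps < kappa by rewrite /kappa; lra.
pose delta := (H^-1 - kappa) * w.
have delta0 : 0 < delta by rewrite mulr_gt0 // subr_gt0.
pose r := 2 / (2 + delta).
have r0 : 0 < r by rewrite divr_gt0 //; lra.
apply: (@le_lt_trans _ _ r); last by rewrite ltr_pdivrMr; lra.
apply: rho_eps_le => [|Delta l De le]; first exact: ltW.
rewrite leNgt; apply/negP => rl.
have l0 : 0 < modulus l by exact: lt_trans rl.
have : kappa <= spectral_norm Delta.
  apply: (modal_gap_le_norm _ _ le); first by lra.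
    by rewrite -modulus_eq0 gt_eqF.
  move=> i; have wi := modal_weight_gt0 i; have [l1|l1] := leP 1 (modulus l).
    apply: le_trans (modal_char_peak_outside i l1).
    by rewrite ler_pM2r // ler_pM2r // ltW.
  have [c1 c2 _] := modal_schur i.
  have cn : `|c_ alpha beta nu (tnth lam i)| <= 1 by rewrite ler_norml !ltW.
  have hin := @quadratic_ge_inside R (b_ alpha beta nu (tnth lam i)) _
    (H^-1 * modal_weight i) cn.
  apply: le_trans (hin _ l _); last 2 first.
  - by move=> u u1; rewrite mulrC ler_pdivrMr // mulrC; exact: peak_max.
  - by rewrite l0 ltW.
  have dl : delta * modulus l <= (H^-1 - kappa) * modal_weight i * modulus l.
    by rewrite ler_pM2r // ler_pM2l ?w_le // subr_gt0.
  have : 2 < modulus l * (2 + delta) by rewrite -ltr_pdivrMr //; lra.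
  by lra.
by lra.
Qed.

(** The modal equation at l = z0, restricted to the plane of the two equal modes, asks
    Delta to act as multiplication by tau = - p(z0) / (w z0), of modulus 1/H. *)
Lemma destabilizing_real : exists Delta : 'M[R[i]]_d,
  [/\ Delta \is a mxOver Num.real, spectral_norm Delta <= H^-1 &
     eigenvalue (closed_loop Delta) z0].
Proof.
have z0n : z0 != 0 by rewrite -modulus_eq0 z01 oner_eq0.
have wi := modal_weight_gt0 i0.
have wC : (modal_weight i0)%:C != 0.
  by rewrite -modulus_eq0 modulus_real normr_eq0 gt_eqF.
pose tau := - modal_char i0 z0 / ((modal_weight i0)%:C * z0).
have tauE : modulus tau = H^-1.
  rewrite /tau modulusM modulusV modulusN modulusM z01 mulr1 modulus_real gtr0_norm //.
  have p0 : modulus (modal_char i0 z0) != 0.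
    by rewrite modulus_eq0 modal_char_neq0 // z01.
  by rewrite peak_attained; field; rewrite p0 gt_eqF.
pose a := complex.Re tau; pose b := complex.Im tau.
have tauC : tau = a%:C + 'i%C * b%:C by rewrite [LHS]complexE.
have tauab : tau = a +i* b by case: (tau) @a @b {tauC}.
pose D := plane_rotation i0 j0 a b.
exists (cplxmx (U *m D)); split.
- by apply/mxOverP => k l; rewrite mxE complex_real.
- rewrite -tauE tauab; apply: spectral_norm_le => [|v]; first exact: modulus_ge0.
  rewrite /cplxmx map_mxM -mulmxA (enorm_orthogonal _ orthogonal_trmx).
  apply: le_trans (enorm_mul_le _ _) _; apply: ler_wpM2r; first exact: enorm_ge0.
  exact: plane_rotation_norm.
apply/eigenvalue_modalP.
pose u : 'cV[R[i]]_d := \col_k (if k == i0 then 1 else if k == j0 then - 'i%C else 0).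
have ui : u i0 0 = 1 by rewrite mxE eqxx.
have uj : u j0 0 = - 'i%C by rewrite mxE eq_sym (negPf ij0) eqxx.
have uk k : k != i0 -> k != j0 -> u k 0 = 0.
  by move=> /negPf ki /negPf kj; rewrite mxE ki kj.
have pj : modal_char j0 z0 = modal_char i0 z0 by rewrite /modal_char double.
exists u; first by apply/cV0Pn; exists i0; rewrite ui oner_eq0.
clearbody u.
have -> : cplxmx (U *m D) = W *m cplxmx D by rewrite /cplxmx map_mxM.
rewrite -mulmxA scalemxAr; congr (_ *m _).
apply/matrixP => k l; rewrite ord1 modal_mxE [RHS]mxE plane_rotationE //.
rewrite !cplx_sqrtE -double ui uj.
have wE : (alpha / Num.sqrt 2)%:C * (Num.sqrt (tnth lam i0))%:C = (modal_weight i0)%:C.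
  by rewrite -rmorphM.
set g := (alpha / _)%:C in wE *; set s := (Num.sqrt _)%:C in wE *.
have pE : modal_char i0 z0 = - (g * z0) * (s * tau).
  move: wC; rewrite /tau -wE mulf_eq0 negb_or => /andP[gn sn].
  by clearbody g s; field; rewrite z0n gn sn.
have ii : 'i%C * 'i%C = -1 :> R[i] by rewrite -expr2 sqr_i.
have [->|ki] := eqVneq k i0; first by rewrite ui pE tauC; ring.
have [->|kj] := eqVneq k j0; last by rewrite uk // !mulr0.
rewrite uj pj pE tauC.
transitivity (g * z0 * s * (a%:C * 'i%C + b%:C * ('i%C * 'i%C))); first by ring.
by rewrite ii; ring.
Qed.

Lemma stab_radius_peak (F : {pred R[i]}) : {subset Num.real <= F} ->
  stab_radius A B T F = (H^-1)%:E.
Proof.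
move=> RF; apply/eqP; rewrite eq_le; apply/andP; split.
  apply: ereal_inf_lbound; exists H^-1 => //; split; first by rewrite invr_gt0.
  have [Delta [DR De le]] := destabilizing_real.
  apply: le_trans (radius_le_rho_eps (Delta := Delta) _ De).
    by rewrite -z01; exact: eigenvalue_le_radius.
  by apply/mxOverP => k l; apply: RF; exact: (mxOverP DR).
apply: le_ereal_inf_tmp => _ [eps [eps0 he] <-]; rewrite lee_fin leNgt.
by apply/negP => /(rho_eps_lt1 F (ltW eps0)); rewrite ltNge he.
Qed.

End Peak.
End Positive.
End ClosedLoop.

(** * Frequency response and the lower bound *)
Section Gain.
Variables (R : realType) (alpha beta nu : R).

Lemma modulus_expi (w : R) : modulus (expi w) = 1.
Proof. by rewrite /modulus /expi /= cos2Dsin2 sqrtr1. Qed.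

Lemma expi_double (w : R) : expi (2 * w) = expi w ^+ 2.
Proof.
rewrite -[2]/(1 + 1) mulrDl mul1r /expi cosD sinD expr2 /=.
by simpc; rewrite [sin w * cos w]mulrC.
Qed.

Lemma gainE (w l : R) : gain alpha beta nu w l =
  Num.sqrt l / modulus (quadratic (b_ alpha beta nu l) (c_ alpha beta nu l) (expi w)).
Proof. by rewrite /gain expi_double. Qed.

(** This is 1 - c_l as a function of x = alpha l. *)
Definition defect (x : R) : R := (1 - beta) + nu * x.

Lemma modal_circle (l : R) z : modulus z = 1 ->
  modulus (quadratic (b_ alpha beta nu l) (c_ alpha beta nu l) z) ^+ 2 =
  circle_sqr (alpha * l) (defect (alpha * l)) (1 - Re z).
Proof.
move=> z1; have -> : defect (alpha * l) = 1 - c_ alpha beta nu l.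
  by rewrite /defect /c_; ring.
by rewrite -quadratic_circle //; congr (modulus (quadratic _ _ _) ^+ 2);
   rewrite /b_ /c_; ring.
Qed.

Lemma gain_continuous (l : R) :
  (forall w, quadratic (b_ alpha beta nu l) (c_ alpha beta nu l) (expi w) != 0) ->
  continuous (fun w => gain alpha beta nu w l).
Proof.
move=> nz.
pose q w := circle_sqr (alpha * l) (defect (alpha * l)) (1 - cos w).
have qE w : modulus (quadratic (b_ alpha beta nu l) (c_ alpha beta nu l) (expi w))
    = Num.sqrt (q w).
  by rewrite /q -[cos w]/(Re (expi w)) -modal_circle ?modulus_expi // sqrtr_sqr
     ger0_norm ?modulus_ge0.
have -> : (fun w => gain alpha beta nu w l) = (fun w => Num.sqrt l * (Num.sqrt (q w))^-1).
  by apply/funext => w; rewrite gainE qE.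
have cq : continuous q.
  move=> w; rewrite /q /circle_sqr.
  have ct : (fun w : R => 1 - cos w) x @[x --> w] --> 1 - cos w.
    by apply: cvgB; [exact: cvg_cst | exact: continuous_cos].
  apply: cvgD; first (apply: cvgB; first exact: cvg_cst).
    by apply: cvgMl; apply: cvgMr.
  by apply: cvgMr; rewrite expr2; apply: cvgM.
move=> w; apply: cvgM; first exact: cvg_cst.
apply: cvgV; first by rewrite -qE modulus_eq0.
apply: (@continuous_comp _ _ _ q Num.sqrt w); first exact: cq.
exact: sqrt_continuous.
Qed.

End Gain.

Lemma sorted_tnth_bounds (R : realType) d (lam : d.-tuple R) (i : 'I_d) :
  sorted <=%R lam -> lam`_0 <= tnth lam i <= lam`_(d - 1).
Proof.
move=> srt; rewrite (tnth_nth 0).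
have mono := le_sorted_leq_nth 0 srt.
have d0 : (0 < d)%N by apply: leq_ltn_trans (ltn_ord i).
by rewrite !mono ?inE ?size_tuple ?ltn_ord //; rewrite ?subn1 ?prednK // -ltnS prednK.
Qed.

(** For repeated extreme eigenvalues the two maxima under the minimum coincide, and
    continuity on a compact interval provides a maximizing frequency. *)
Lemma Hlb_attained (R : realType) (alpha beta nu mu L : R) :
  (forall w, quadratic (b_ alpha beta nu mu) (c_ alpha beta nu mu) (expi w) != 0) ->
  (forall w, quadratic (b_ alpha beta nu L) (c_ alpha beta nu L) (expi w) != 0) ->
  exists w0, let M := Num.max (gain alpha beta nu w0 mu) (gain alpha beta nu w0 L) in
    Hlb alpha beta nu mu mu L L = alpha / Num.sqrt 2 * M /\
    forall w, 0 <= w <= 2 * pi ->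
      gain alpha beta nu w mu <= M /\ gain alpha beta nu w L <= M.
Proof.
move=> nzmu nzL.
pose h w := Num.max (gain alpha beta nu w mu) (gain alpha beta nu w L).
have ch : continuous h.
  by move=> w; apply: (@continuous_max R R (gain alpha beta nu ^~ mu)
    (gain alpha beta nu ^~ L)); apply: gain_continuous.
have pi2 : 0 <= 2 * pi :> R by rewrite mulr_ge0 // pi_ge0.
have [w0 w0b hmax] := @EVT_max R h 0 (2 * pi) pi2 (continuous_subspaceT ch).
have ub w : 0 <= w <= 2 * pi -> h w <= h w0 by move=> wb; apply: hmax; rewrite in_itv.
exists w0 => M; split; last first.
  by move=> w /ub; rewrite /h ge_max => /andP.
have minE w : Num.min (Num.max (gain alpha beta nu w mu) (gain alpha beta nu w L))
   (Num.max (gain alpha beta nu w mu) (gain alpha beta nu w L)) = h w by rewrite minxx.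
congr (_ * _); apply/eqP; rewrite eq_le; apply/andP; split.
  apply: ge_sup; first by exists (h w0), w0; rewrite ?minE //; move: w0b; rewrite in_itv.
  by move=> _ [w wb <-]; rewrite minE; exact: ub.
apply: (@le_sup_bounded _ _ (h w0)); first by move=> _ [w wb <-]; rewrite minE; exact: ub.
by exists w0; rewrite ?minE //; move: w0b; rewrite in_itv.
Qed.

Theorem corollary4p9 (R : realType) (d : nat)
    (Q : 'M[R]_d) (p : 'cV[R]_d) (r : R) (f : 'cV[R]_d -> R)
    (U : 'M[R]_d) (lam : d.-tuple R) (mu L alpha beta nu : R)
    (hd : (4 <= d)%N)
    (hf : forall x : 'cV[R]_d,
        f x = 2^-1 * (x^T *m Q *m x) 0 0 + (p^T *m x) 0 0 + r)
    (Qsym : Q^T = Q)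
    (Qpos : forall x : 'cV[R]_d, x != 0 -> 0 < (x^T *m Q *m x) 0 0)
    (Uorth : U *m U^T = 1%:M)
    (lam_sorted : sorted <=%R lam)
    (Qdiag : Q = U *m Lambda lam *m U^T)
    (hmu : mu = lam`_0) (hL : L = lam`_(d - 1))
    (mu_gt0 : 0 < mu) (mu_lt_L : mu < L)
    (alpha_gt0 : 0 < alpha) (beta_ge0 : 0 <= beta) (nu_ge0 : 0 <= nu)
    (stable : spectral_radius (cplxmx (AQ alpha beta nu Q)) < 1)
    (lam2 : lam`_1 = mu) (lamd1 : lam`_(d - 2) = L) :
  [/\ real_stab_radius (AQ alpha beta nu Q) (Bmx d alpha) (Tmx U lam)
      = complex_stab_radius (AQ alpha beta nu Q) (Bmx d alpha) (Tmx U lam),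
      complex_stab_radius (AQ alpha beta nu Q) (Bmx d alpha) (Tmx U lam)
      = ((Hlb alpha beta nu mu lam`_1 lam`_(d - 2) L)^-1)%:E
    & (Hlb alpha beta nu mu lam`_1 lam`_(d - 2) L)^-1
      = (Hinf (AQ alpha beta nu Q) (Bmx d alpha) (Tmx U lam))^-1].
Proof.
have lamb i : mu <= tnth lam i <= L by rewrite hmu hL; exact: sorted_tnth_bounds.
have mu_le i : mu <= tnth lam i by case/andP: (lamb i).
have [i1 [j1 [ij1 i1E j1E]]] : exists i j : 'I_d,
    [/\ i != j, tnth lam i = mu & tnth lam j = mu].
  have d0 : (0 < d)%N by apply: leq_trans hd.
  have d1 : (1 < d)%N by apply: leq_trans hd.
  by exists (Ordinal d0), (Ordinal d1); rewrite !(tnth_nth 0) /= -hmu lam2.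
have [i2 [j2 [ij2 i2E j2E]]] : exists i j : 'I_d,
    [/\ i != j, tnth lam i = L & tnth lam j = L].
  have d1 : (d - 2 < d)%N by rewrite ltn_subrL /= (leq_trans _ hd).
  have d0 : (d - 1 < d)%N by rewrite ltn_subrL /= (leq_trans _ hd).
  exists (Ordinal d1), (Ordinal d0); rewrite !(tnth_nth 0) /= -hL lamd1; split=> //.
  by rewrite -val_eqE /= neq_ltn ltn_sub2l // (leq_trans _ hd).
rewrite lam2 lamd1.
have nz i w : modal_char alpha beta nu lam i (expi w) != 0.
  by apply: (modal_char_neq0 Uorth Qdiag mu_gt0 mu_le alpha_gt0 stable);
     rewrite modulus_expi.
have nzmu w : quadratic (b_ alpha beta nu mu) (c_ alpha beta nu mu) (expi w) != 0.
  by rewrite -i1E; exact: nz.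
have nzL w : quadratic (b_ alpha beta nu L) (c_ alpha beta nu L) (expi w) != 0.
  by rewrite -i2E; exact: nz.
have [w0 [HE Mub]] := Hlb_attained nzmu nzL.
set M := Num.max _ _ in HE Mub.
have gain_gt0 w : 0 < gain alpha beta nu w mu.
  rewrite gainE; apply: divr_gt0; first by rewrite sqrtr_gt0.
  by rewrite lt_def modulus_ge0 modulus_eq0 nzmu.
have M0 : 0 < M by rewrite lt_max gain_gt0.
have g0 := gain_factor_gt0 alpha_gt0.
set H := Hlb _ _ _ _ _ _ _ in HE *.
have H0 : 0 < H by rewrite HE mulr_gt0.
(* Whichever extreme mode attains the maximum M, its eigenvalue is repeated. *)
have [i0 [j0 [ij0 dbl gainM]]] : exists i0 j0 : 'I_d, [/\ i0 != j0,
    tnth lam i0 = tnth lam j0 & gain alpha beta nu w0 (tnth lam i0) = M].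
  have [le|lt] := leP (gain alpha beta nu w0 L) (gain alpha beta nu w0 mu).
    by exists i1, j1; rewrite i1E j1E /M; split => //; rewrite max_l.
  by exists i2, j2; rewrite i2E j2E /M; split => //; rewrite max_r // ltW.
have attained : modal_weight alpha lam i0 =
    H * modulus (modal_char alpha beta nu lam i0 (expi w0)).
  rewrite HE -gainM gainE /modal_weight /modal_char -[RHS]mulrA divfK //.
  by rewrite modulus_eq0; exact: nz.
(* gain <= M for the eigenvalue l means |p_l|^2 >= l / M^2 = K * (alpha * l). *)
pose K := (alpha * M ^+ 2)^-1.
have K0 : 0 <= K by rewrite invr_ge0 mulr_ge0 ?sqr_ge0 // ltW.
have ext l t : 0 < l ->
    (forall w, quadratic (b_ alpha beta nu l) (c_ alpha beta nu l) (expi w) != 0) ->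
    (forall w, 0 <= w <= 2 * pi -> gain alpha beta nu w l <= M) ->
    0 <= t <= 2 ->
    K * (alpha * l) <= circle_sqr (alpha * l) (defect beta nu (alpha * l)) t.
  move=> l0 nzl gl /andP[t0 t2].
  have tb : -1 <= 1 - t <= 1 by apply/andP; split; lra.
  have wb : 0 <= acos (1 - t) <= 2 * pi.
    rewrite acos_ge0 //= (le_trans (acos_lepi tb)) //.
    by have := pi_ge0 R; lra.
  have := gl _ wb; rewrite gainE.
  set z := expi _; have z1 : modulus z = 1 by exact: modulus_expi.
  have ReE : 1 - Re z = t.
    rewrite /z /expi /= acosK ?in_itv //=; lra.
  have qp : 0 < modulus (quadratic (b_ alpha beta nu l) (c_ alpha beta nu l) z).
    by rewrite lt_def modulus_ge0 modulus_eq0 nzl.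
  rewrite ler_pdivrMr // => hq.
  rewrite -[in leRHS]ReE -modal_circle //.
  have -> : K * (alpha * l) = l / M ^+ 2.
    by rewrite /K; field; rewrite !gt_eqF.
  rewrite ler_pdivrMr ?exprn_gt0 // mulrC -exprMn -[leLHS](sqr_sqrtr (ltW l0)).
  rewrite ler_sqr ?nnegrE ?sqrtr_ge0 ?mulr_ge0 ?modulus_ge0 ?(ltW M0) //.
have peak i z : modulus z = 1 -> modal_weight alpha lam i <=
    H * modulus (modal_char alpha beta nu lam i z).
  move=> z1; rewrite HE /modal_weight -[leRHS]mulrA ler_pM2l //.
  have li0 : 0 < tnth lam i by exact: lt_le_trans (mu_le i).
  have Rez : -1 <= Re z <= 1.
    have := modulus_eq1 z1; have := sqr_ge0 (Im z) => h1 h2.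
    have x1 : Re z ^+ 2 <= 1 by lra.
    by apply/andP; split; nra.
  have tb : 0 <= 1 - Re z <= 2 by move: Rez => /andP[? ?]; apply/andP; split; lra.
  have schur := modal_schur Uorth Qdiag mu_gt0 mu_le alpha_gt0 stable.
  have [_ cmu _] := schur i1; have [_ _ /andP[_ bL]] := schur i2.
  rewrite i1E in cmu; rewrite i2E in bL.
  have := @circle_sqr_between R K nu (1 - beta) (alpha * mu) (alpha * tnth lam i)
    (alpha * L) K0 nu_ge0.
  have e1 : 0 < 1 - beta + nu * (alpha * mu).
    by move: cmu; rewrite /c_; lra.
  have e2 : 0 < 4 - 2 * (1 - beta + nu * (alpha * L)) - alpha * L.
    by move: bL; rewrite /c_ /b_; lra.
  have [lb1 lb2] := andP (lamb i).
  rewrite /= mulr_gt0 // !ler_pM2l // lamb => /(_ isT isT e1 e2).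
  have L0 : 0 < L by exact: lt_trans mu_lt_L.
  move=> /(_ (fun t tb => ext mu t mu_gt0 nzmu (fun w wb => (Mub w wb).1) tb)).
  move=> /(_ (fun t tb => ext L t L0 nzL (fun w wb => (Mub w wb).2) tb) _ tb).
  rewrite -/(defect beta nu _) -modal_circle //.
  have -> : K * (alpha * tnth lam i) = tnth lam i / M ^+ 2.
    by rewrite /K; field; rewrite !gt_eqF.
  rewrite ler_pdivrMr ?exprn_gt0 // [leRHS]mulrC -exprMn -[leLHS](sqr_sqrtr (ltW li0)).
  by rewrite ler_sqr ?nnegrE ?sqrtr_ge0 ?mulr_ge0 ?modulus_ge0 ?(ltW M0).
have radius F := @stab_radius_peak _ _ _ _ _ _ _ _ Uorth Qdiag _ mu_gt0 mu_le
  alpha_gt0 stable _ H0 peak _ _ _ ij0 dbl (modulus_expi w0) attained F.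
have hinf := @Hinf_peak _ _ _ _ _ _ _ _ Uorth Qdiag _ mu_gt0 mu_le
  alpha_gt0 stable _ H0 peak _ _ (modulus_expi w0) attained.
by rewrite hinf /real_stab_radius /complex_stab_radius !radius.
Qed.
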